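(* Fix $\frac12<\beta\le1$. For every $n\ge1$ let $V_n=\{1,\dots,n\}\times\{1,\dots,n\}$ and, for all $a,b\in\{1,\dots,n\}$, let $\mathbb S_{\mathsf v}(a)\subseteq\{a\}\times\{1,\dots,n\}$ and $\mathbb S_{\mathsf h}(b)\subseteq\{1,\dots,n\}\times\{b\}$ be subsets (possibly depending on $n$) with $$|\mathbb S_{\mathsf v}(a)|=|\mathbb S_{\mathsf h}(b)|=\lfloor\beta n\rfloor .$$ Let $E_n$ be the set of pairs $(v_1,v_2)\in V_n\times V_n$ with $v_1\ne v_2$ such that either $v_1,v_2\in\mathbb S_{\mathsf h}(b)$ for some $b$, or $v_1,v_2\in\mathbb S_{\mathsf v}(a)$ for some $a$. Let $$Z_n=\sum_{v_1,v_2\in V_n}\mathbf 1_{E_n}(v_1,v_2)\,X_{v_1}X_{v_2}.$$ Then $\{Z_n\}$ verifies an irreducible CLT.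
   Context: $\{X_v: v\in\bigcup_nV_n\}$ are i.i.d. standard normal random variables. For $B\subset V_n$ put $\sigma_n^2(B)=2\,|E_n\cap(B\times B)|$. The sequence $\{Z_n\}$ is reducible if for every $n$ there exist pairwise disjoint subsets $B_1,\dots,B_{m_n}\subset V_n$ (depending on $n$) such that, as $n\to\infty$: (i) $m_n\to\infty$; (ii) $\frac1{2|E_n|}\sum_{i=1}^{m_n}\sigma_n^2(B_i)\to1$; (iii) $\frac1{2|E_n|}\max_{i=1,\dots,m_n}\sigma_n^2(B_i)\to0$. It is irreducible if no such choice exists. $\{Z_n\}$ verifies an irreducible CLT if it is irreducible and $Z_n/\sqrt{2|E_n|}$ converges in distribution, as $n\to\infty$, to a standard normal random variable. *)

(* Defs.v *)
From HB Require Import structures.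
From mathcomp Require Import all_boot all_order all_algebra.
From mathcomp Require Import all_classical all_reals all_analysis.
(* Not exported by all_analysis; it provides the ring structure on measurable
   functions. *)
From mathcomp Require Import measurable_realfun.

Set Implicit Arguments.
Unset Strict Implicit.
Unset Printing Implicit Defensive.

Import Order.TTheory GRing.Theory Num.Theory.
Import numFieldNormedType.Exports.

Local Open Scope classical_set_scope.
Local Open Scope ring_scope.

Definition mutually_independent (d : measure_display) (T : measurableType d)
    (R : realType) (P : probability T R) (I : eqType)
    (X : I -> {RV P >-> R}) : Prop :=
  forall (s : seq I) (A : I -> set R), uniq s -> (forall i, measurable (A i)) ->
    P (\bigcap_(i in [set` s]) (X i @^-1` A i))
    = (\prod_(i <- s) P (X i @^-1` A i))%E.

Definition iid_standard_normal (d : measure_display) (T : measurableType d)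
    (R : realType) (P : probability T R) (I : eqType)
    (X : I -> {RV P >-> R}) : Prop :=
  mutually_independent X /\
  forall (i : I) (A : set R), measurable A ->
    distribution P (X i) A = normal_prob 0 1 A.

(* Convergence of the distribution functions at every continuity point of the
   limiting one. *)
Definition cvg_in_distribution (d : measure_display) (T : measurableType d)
    (R : realType) (P : probability T R) (Y : nat -> {RV P >-> R})
    (mu : probability (measurableTypeR R) R) : Prop :=
  forall x : R, {for x, continuous (fun r : R => mu `]-oo, r]%classic)} ->
    cdf (Y n) x @[n --> \oo] --> mu `]-oo, x]%classic.

Definition sigma2 (V : finType) (E : {set V * V}) (B : {set V}) : nat :=
  2 * #|E :&: finset.setX B B|.

(* Reducibility of Z_n only depends on the edge sets E_n. *)
Definition reducible (R : realType) (V : nat -> finType)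
    (E : forall n, {set V n * V n}) : Prop :=
  exists (m : nat -> nat) (B : forall n, 'I_(m n) -> {set V n}),
    [/\ forall n (i j : 'I_(m n)), i != j -> [disjoint B n i & B n j]%B,
        m n @[n --> \oo] --> \oo,
        (2 * #|E n|)%N%:R^-1 * (\sum_(i < m n) sigma2 (E n) (B n i))%N%:R
          @[n --> \oo] --> (1 : R) &
        (2 * #|E n|)%N%:R^-1 * (\max_(i < m n) sigma2 (E n) (B n i))%N%:R
          @[n --> \oo] --> (0 : R)].

Definition irreducible (R : realType) (V : nat -> finType)
    (E : forall n, {set V n * V n}) : Prop := ~ reducible R E.

(* The sum runs over ordered pairs, so each unordered edge counts twice. *)
Definition edge_form (d : measure_display) (T : measurableType d)
    (R : realType) (P : probability T R) (V : finType) (E : {set V * V})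
    (X : V -> {RV P >-> R}) : {RV P >-> R} :=
  \sum_(v1 : V) \sum_(v2 : V)
    (((v1, v2) \in E)%:R * (X v1 : {mfun T >-> R}) * (X v2 : {mfun T >-> R})).

Definition verifies_irreducible_CLT (d : measure_display)
    (T : measurableType d) (R : realType) (P : probability T R)
    (V : nat -> finType) (E : forall n, {set V n * V n})
    (Z : nat -> {RV P >-> R}) : Prop :=
  irreducible R E /\
  cvg_in_distribution
    (fun n => (Num.sqrt (2 * #|E n|)%N%:R)^-1 \o* Z n : {RV P >-> R})
    (normal_prob 0 1).

Local Close Scope classical_set_scope.

(* Coordinates are numbered from 0: {0, ..., n-1} x {0, ..., n-1}. *)
Definition grid (n : nat) : finType := ('I_n * 'I_n)%type.

Definition grid_edges (n : nat) (Sv Sh : 'I_n -> {set grid n}) :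
    {set grid n * grid n} :=
  [set p : grid n * grid n | (p.1 != p.2) &&
     ([exists b, (p.1 \in Sh b) && (p.2 \in Sh b)] ||
      [exists a, (p.1 \in Sv a) && (p.2 \in Sv a)])].

(* Main.v *)
Require Import Defs.
From HB Require Import structures.
From mathcomp Require Import all_boot all_order all_algebra.
From mathcomp Require Import all_classical all_reals all_analysis.
From mathcomp Require Import measurable_realfun zify ring lra.

(**
The form [Z_n] equals [X^T A X], where [A] is the adjacency matrix of [E_n] and
[X] a standard Gaussian vector. With [k] the common size of the selected parts of
the lines of the grid, [|E_n| = 2 n k (k - 1)] is of order [n^3], while every
vertex has at most [2 n] neighbours. The two halves of the theorem are
independent.

Central limit theorem. Stein's method reduces convergence in distribution to
[E (f'(F) - F f(F)) -> 0] for [F = Z_n / sqrt (2 |E_n|)] and [f] with a bounded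
continuous derivative: if [f] solves Stein's equation [f' - x f = h - int h] for a
bounded continuous [h] ([stein_equation_solution]), this expectation is the
difference between [E h(F)] and the Gaussian integral of [h]. For a symmetric
matrix [M] and [Q = X^T M X], integrating by parts in each Gaussian coordinate
while the independent others are frozen ([gaussian_ibp_freezing],
[gaussian_ibp_coordinate]) and summing over the coordinates gives
[E (Q g(Q)) = tr M * E g(Q) + 2 E (|M X|^2 g'(Q))] ([gaussian_ibp_quad_form]).
This identity is used twice. With [M = A], whose trace vanishes, it reduces the
claim to the concentration of [|A X|^2 / |E_n|] around [1]. Since [|A X|^2] is
the quadratic form of [A^2], the identity with [M = A^2] and [g] affine gives its
variance, namely [2 tr (A^4)] ([variance_quad_form]). Finally [tr (A^4)] counts
closed walks of length four, so that it is at most [|E_n| (2 n)^2]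
([trace_pow4_adjacency]), and [tr (A^4) / |E_n|^2] is of order [1 / n].

Irreducibility. Let disjoint blocks [B_i] contain almost all the edges. Edges are
pairs inside a row or inside a column, so a line whose trace is cut into pieces by
the blocks loses edges: almost all the points selected on almost every line lie in
one block, the main block of that line. As [k > n / 2], the points selected on
rows and those selected on columns must overlap: there are about [(2 k - n) n]
points lying in the main block of both their row and their column. Blocks being
disjoint, the two main blocks then agree ([main_mass_le]). Hence some block is the
main block of about [2 k - n] rows, and contains a positive proportion of the edges
([blocks_edges_bound]), which contradicts the negligibility of the largest block.
*)

Set Implicit Arguments.
Unset Strict Implicit.
Unset Printing Implicit Defensive.

Import Order.TTheory GRing.Theory Num.Theory.
Import numFieldNormedType.Exports.

Local Open Scope classical_set_scope.
Local Open Scope ring_scope.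

(** * Integration against the standard normal law *)

Section gauss.
Context {R : realType}.
Notation gam := (normal_prob (0 : R) 1).
Notation leb := (@lebesgue_measure R).
Notation phi := (normal_pdf (0 : R) 1).

(** The density of the normal law is only known as a function whose integrals over
    measurable sets are the measures of these sets; uniqueness of the
    Radon-Nikodym derivative turns it into a rule for integrals. *)
Lemma ge0_integral_normal (f : R -> \bar R) :
  measurable_fun setT f -> (forall x, 0 <= f x)%E ->
  (\int[gam]_x f x = \int[leb]_x (f x * (phi x)%:E))%E.
Proof.
move=> mf f0; have dom := normal_prob_dominates (0 : R) 1.
rewrite -(Radon_Nikodym_SigmaFinite.change_of_variables dom f0)//.
have iRN := Radon_Nikodym_SigmaFinite.f_integrable dom.
have mphi : measurable_fun [set: R] (EFin \o phi).
  by apply/measurable_EFinP; exact: measurable_normal_pdf.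
apply: ae_eq_integral => //.
- by apply: emeasurable_funM => //; exact: measurable_int iRN.
- exact: emeasurable_funM.
- apply: ae_eqe_mul2l; apply: integral_ae_eq => // A _ mA.
  by rewrite -Radon_Nikodym_SigmaFinite.f_integral.
Qed.

Lemma integrable_normal (f : R -> R) : measurable_fun setT f ->
  leb.-integrable setT (fun x => (f x * phi x)%:E) ->
  gam.-integrable setT (EFin \o f).
Proof.
move=> mf /integrableP[_ fi]; apply/integrableP; split.
  exact/measurable_EFinP.
rewrite ge0_integral_normal//; last first.
  by apply/measurableT_comp => //; exact/measurable_EFinP.
apply: le_lt_trans fi; rewrite le_eqVlt; apply/orP; left; apply/eqP.
apply: eq_integral => x _ /=.
by rewrite -EFinM normrM (ger0_norm (normal_pdf_ge0 _ _ _)).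
Qed.

Lemma integrable_mul_normal_pdf (f : R -> R) :
  gam.-integrable setT (EFin \o f) ->
  leb.-integrable setT (EFin \o (fun x => f x * phi x)).
Proof.
move=> /integrableP[/measurable_EFinP mf fi]; apply/integrableP; split.
  apply/measurable_EFinP; apply: measurable_funM => //.
  exact: measurable_normal_pdf.
apply: le_lt_trans fi; rewrite ge0_integral_normal//; last first.
  by apply/measurableT_comp => //; exact/measurable_EFinP.
rewrite le_eqVlt; apply/orP; left; apply/eqP; apply: eq_integral => x _ /=.
by rewrite -EFinM normrM (ger0_norm (normal_pdf_ge0 _ _ _)).
Qed.

Lemma Rintegral_normal (f : R -> R) : gam.-integrable setT (EFin \o f) ->
  \int[gam]_x f x = \int[leb]_x (f x * phi x).
Proof.
move=> fi; have mf := measurable_int _ fi.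
congr fine; rewrite integralE [RHS]integralE.
have phi0 x : (0 <= (phi x)%:E)%E by rewrite lee_fin normal_pdf_ge0.
rewrite !ge0_integral_normal//; last 2 first.
- exact: measurable_funeneg.
- exact: measurable_funepos.
by congr (_ - _)%E; apply: eq_integral => x _; rewrite !(funeposE, funenegE) /=
  -?EFinN -!EFin_max -EFinM maxr_pMl ?normal_pdf_ge0// ?mulNr mul0r.
Qed.
End gauss.

(** * One-dimensional Gaussian integration by parts *)

Section gauss2.
Context {R : realType}.
Notation gam := (normal_prob (0 : R) 1).
Notation leb := (@lebesgue_measure R).
Notation phi := (normal_pdf (0 : R) 1).

Lemma std_normal_pdfE (x : R) :
  phi x = normal_peak 1 * expR (- (x ^+ 2 / 2)).
Proof.
by rewrite normal_pdfE ?oner_eq0// /normal_fun subr0 expr1n mulNr.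
Qed.

Lemma std_normal_pdf_gt0 (x : R) : 0 < phi x.
Proof.
by rewrite std_normal_pdfE mulr_gt0 ?expR_gt0// normal_peak_gt0 ?oner_eq0.
Qed.

Lemma is_derive_std_normal_pdf (x : R) : is_derive x 1 phi (- x * phi x).
Proof.
have -> : phi = (fun x : R => normal_peak 1 * expR (- (x ^+ 2 / 2))).
  by apply/funext => y; rewrite std_normal_pdfE.
have h : is_derive x 1 (fun y : R => y ^+ 2 / 2) x.
  by apply: is_derive_eq; rewrite !scaler1 /GRing.scale/=; lra.
apply: is_derive_eq; rewrite /GRing.scale/=; lra.
Qed.

Lemma expR_sqr_div4_std_normal_pdf (x : R) : expR (x ^+ 2 / 4) * phi x =
  normal_peak 1 * expR (- (x ^+ 2 / 4)).
Proof.
by rewrite std_normal_pdfE mulrCA -expRD; congr (_ * expR _); lra.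
Qed.

Lemma integrable_expR_sqr_div4 :
  gam.-integrable setT (EFin \o (fun x : R => expR (x ^+ 2 / 4))).
Proof.
apply: integrable_normal.
  apply: continuous_measurable_fun => x.
  by apply: continuous_comp; [apply: cvgMl; exact: exprn_continuous
    |exact: continuous_expR].
(* Up to a constant, the integrand is the centered normal density of variance 2. *)
pose s : R := Num.sqrt 2.
have s0 : s != 0 by rewrite sqrtr_eq0 -ltNge.
pose c := normal_peak 1 / normal_peak s.
rewrite (_ : (fun _ => _) = (fun x => c%:E * (normal_pdf 0 s x)%:E)%E).
  by apply: integrableZl => //; exact: integrable_normal_pdf.
apply/funext => x; rewrite expR_sqr_div4_std_normal_pdf -EFinM; congr EFin.
rewrite normal_pdfE// mulrA /c divfK ?gt_eqF ?normal_peak_gt0//.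
congr (_ * expR _); rewrite subr0 sqr_sqrtr//; lra.
Qed.

(** The function [expR (x ^+ 2 / 8)] is used as a common majorant of the polynomials
    of degree at most four; multiplied by [`|x|] it stays below
    [2 * expR (x ^+ 2 / 4)], which is still integrable for the normal law. *)
Lemma expR_sqr_div8_ge (x : R) :
  [/\ 1 <= expR (x ^+ 2 / 8), `|x| <= 2 * expR (x ^+ 2 / 8) &
      x ^+ 4 <= 128 * expR (x ^+ 2 / 8)].
Proof.
have y0 : 0 <= x ^+ 2 / 8 by rewrite divr_ge0// sqr_ge0.
have := expR_ge1Dxn 0 y0; have := expR_ge1Dxn 1 y0.
rewrite expr1 (_ : (2`!)%:R = 2 :> R)// (_ : (1`!)%:R = 1 :> R)// divr1.
move: y0; set e := expR _ => y0.
have -> : (x ^+ 2 / 8) ^+ 2 / 2 = x ^+ 4 / 128 by field.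
have := sqr_ge0 (`|x| / 2 - 1); have := real_normK (num_real x).
set a := `|x|; move=> ? ? ? ?; split; nra.
Qed.

Lemma le_gaussian_growth (C y : R) (f : R -> R) :
  (forall x, `|f x| <= C * expR (x ^+ 2 / 8)) ->
  `|y * f y| <= 2 * C * expR (y ^+ 2 / 4) /\ `|f y| <= C * expR (y ^+ 2 / 4).
Proof.
move=> /(_ y) fC; have [e1 ye _] := expR_sqr_div8_ge y.
have -> : y ^+ 2 / 4 = y ^+ 2 / 8 + y ^+ 2 / 8 by lra.
rewrite expRD normrM; have := normr_ge0 (f y); have := normr_ge0 y.
by move: fC e1 ye; set e := expR _; set a := `|y|; set b := `|f y| => *; nra.
Qed.

(** The fundamental theorem of calculus on the symmetric segments
    [[- n.+1, n.+1]], dominated convergence taking care of the integrals. *)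
Lemma Rintegral_derive_setT (H h : R -> R) :
  (forall x : R, is_derive x 1 H (h x)) -> continuous h ->
  leb.-integrable setT (EFin \o h) ->
  H n%:R @[n --> \oo] --> (0 : R) -> H (- n%:R) @[n --> \oo] --> (0 : R) ->
  \int[leb]_x h x = 0.
Proof.
move=> dH ch ih H1 H2.
have mh : measurable_fun setT h by exact: continuous_measurable_fun.
have FTC n : (\int[leb]_x ((h \_ `[(- n.+1%:R : R), n.+1%:R]) x)%:E =
   (H n.+1%:R - H (- n.+1%:R))%:E)%E.
  transitivity (\int[leb]_(x in `[(- n.+1%:R)%R, n.+1%:R%R]) (h x)%:E)%E.
    by rewrite [RHS]integral_mkcond; apply: eq_integral => x _; rewrite !patchE; case: ifP.
  apply: continuous_FTC2.
  - by rewrite -subr_gt0 opprK addr_gt0.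
  - by apply: continuous_subspaceT.
  - split.
    + by move=> x _; have [] := dH x.
    + apply: cvg_at_right_filter; apply: differentiable_continuous.
      by apply/derivable1_diffP; have [] := dH (- n.+1%:R).
    + apply: cvg_at_left_filter; apply: differentiable_continuous.
      by apply/derivable1_diffP; have [] := dH (n.+1%:R).
  - by move=> x _; rewrite derive1E; have [_ ->] := dH x.
have [|||||_ _ dc] := @dominated_convergence _ _ _ leb setT measurableT
  (fun n x => ((h \_ `[(- n.+1%:R : R), n.+1%:R]) x)%:E) (EFin \o h)
  (fun x => `|h x|%:E).
- move=> n; apply/measurable_EFinP.
  apply: (measurable_restrictT _ (measurable_itv _)).1; exact: measurable_funTS.
- exact/measurable_EFinP.
- apply: aeW => x _.
  apply: cvg_near_cst; near=> n; rewrite patchE mem_set//=.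
  rewrite in_itv/= -ler_norml; apply: (@le_trans _ _ n%:R); last by rewrite ler_nat.
  by near: n; exact: nbhs_infty_ger.
- exact: integrable_norm.
- apply: aeW => x n _ /=; rewrite patchE; case: ifP => //=.
  by rewrite normr0 lee_fin.
have : (fun n => (H n.+1%:R - H (- n.+1%:R))%:E) @ \oo --> 0%E.
  apply: cvg_EFin; first exact: nearW.
  rewrite -[X in _ --> X]subr0; apply: cvgB; by rewrite (@cvg_shiftS _ (fun n => H _)).
under eq_fun do rewrite -FTC.
by move=> dc0; rewrite /Rintegral (cvg_unique (@ereal_hausdorff R) dc dc0).
Unshelve. all: by end_near. Qed.

Lemma cvg_gaussian_tail (C : R) (H : R -> R) (u : nat -> R) :
  (forall x, `|H x| <= C * expR (- (x ^+ 2 / 4))) ->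
  (forall n, u n ^+ 2 = n%:R ^+ 2) -> H (u n) @[n --> \oo] --> (0 : R).
Proof.
move=> HC uE; have C0 : 0 <= C.
  by move: (le_trans (normr_ge0 _) (HC 0)); rewrite pmulr_lge0 ?expR_gt0.
have bound n : `|H (u n)| <= 2 * C * harmonic n.
  apply: le_trans (HC _) _; rewrite uE expRN (_ : 2 * C * _ = C * (2 * harmonic n)); last by ring.
  rewrite ler_wpM2l//.
  rewrite /harmonic/= -[2]invrK -invfM lef_pV2 ?posrE ?expR_gt0 ?mulr_gt0//.
  have : 0 <= n%:R ^+ 2 / 4 :> R by rewrite divr_ge0// sqr_ge0.
  move=> /(expR_ge1Dxn 0); rewrite expr1 (_ : (1`!)%:R = 1 :> R)// divr1.
  have := sqr_ge0 (n%:R - 1 : R); set e := expR _; rewrite -(natr1 n); nra.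
have h0 : 2 * C * harmonic n @[n --> \oo] --> (0 : R).
  by rewrite -[X in _ --> X](mulr0 (2 * C)); apply: cvgMr; exact: cvg_harmonic.
apply: (squeeze_cvgr _ _ h0); last by rewrite -[X in _ --> X]oppr0; exact: (cvgN h0).
by apply: nearW => n; rewrite -ler_norml.
Qed.

(** The derivative of [- f * phi], for [phi] the normal density, is
    [(x * f x - f' x) * phi x], and its integral vanishes because [f * phi] tends
    to [0] at both infinities. *)
Lemma gaussian_ibp (f f' : R -> R) (C : R) :
  (forall x : R, is_derive x 1 f (f' x)) -> continuous f' ->
  (forall x, `|f x| <= C * expR (x ^+ 2 / 8)) ->
  (forall x, `|f' x| <= C * expR (x ^+ 2 / 8)) ->
  [/\ gam.-integrable setT (EFin \o (fun x => x * f x)),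
      gam.-integrable setT (EFin \o f') &
      \int[gam]_x (x * f x) = \int[gam]_x f' x].
Proof.
move=> df cf' fC f'C.
have cf : continuous f.
  move=> x; apply: differentiable_continuous.
  by apply/derivable1_diffP; have [] := df x.
have mf : measurable_fun setT f by exact: continuous_measurable_fun.
have mf' : measurable_fun setT f' by exact: continuous_measurable_fun.
have iexp K : gam.-integrable setT (fun x : R => (K * expR (x ^+ 2 / 4))%:E).
  by apply: (integrableZl measurableT K integrable_expR_sqr_div4).
have ixf : gam.-integrable setT (EFin \o (fun x => x * f x)).
  apply: le_integrable (iexp (2 * C)) => //.
    by apply/measurable_EFinP; exact: measurable_funM.
  move=> x _; rewrite lee_fin/= [leRHS]ger0_norm.
    by have [] := le_gaussian_growth x fC.
  by have [/(le_trans (normr_ge0 _))] := le_gaussian_growth x fC.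
have if' : gam.-integrable setT (EFin \o f').
  apply: le_integrable (iexp C) => //; first exact/measurable_EFinP.
  move=> x _; rewrite lee_fin/= [leRHS]ger0_norm.
    by have [] := le_gaussian_growth x f'C.
  by have [_ /(le_trans (normr_ge0 _))] := le_gaussian_growth x f'C.
split => //; rewrite (Rintegral_normal ixf) (Rintegral_normal if').
have cphi : continuous phi by apply: continuous_normal_pdf; exact: oner_neq0.
have ixf' := integrable_mul_normal_pdf ixf.
have if'' := integrable_mul_normal_pdf if'.
apply/eqP; rewrite -subr_eq0 -RintegralB//; apply/eqP.
have HC x : `|- (f x * phi x)| <= C * normal_peak 1 * expR (- (x ^+ 2 / 4)).
  have [_ /(ler_wpM2r (ltW (std_normal_pdf_gt0 x)))] := le_gaussian_growth x fC.
  rewrite -[leRHS]mulrA expR_sqr_div4_std_normal_pdf [leRHS]mulrA normrN normrM.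
  by rewrite (ger0_norm (normal_pdf_ge0 _ _ _)).
apply: (@Rintegral_derive_setT (fun x => - (f x * phi x))).
- move=> x; have dfx := df x; have dphix := is_derive_std_normal_pdf x.
  by apply: is_derive_eq; rewrite /GRing.scale/=; ring.
- move=> x; apply: cvgB; apply: cvgM => //.
  + by apply: cvgM => //; exact: cf.
  + exact: cphi.
  + exact: cf'.
  + exact: cphi.
- exact: (integrableB _ ixf' if'').
- exact: (@cvg_gaussian_tail _ (fun x => - (f x * phi x)) (fun n => n%:R) HC).
- apply: (@cvg_gaussian_tail _ (fun x => - (f x * phi x)) (fun n => - n%:R) HC).
  by move=> n; rewrite sqrrN.
Qed.
End gauss2.

(** * Stein's equation *)

Section stein.
Context {R : realType}.
Notation gam := (normal_prob (0 : R) 1).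
Notation leb := (@lebesgue_measure R).
Notation phi := (normal_pdf (0 : R) 1).

Lemma continuous_std_normal_pdf : continuous phi.
Proof. by apply: continuous_normal_pdf; exact: oner_neq0. Qed.

Lemma std_normal_pdfN (x : R) : phi (- x) = phi x.
Proof. by rewrite !std_normal_pdfE sqrrN. Qed.

Lemma cvg_std_normal_pdf_pinfty : phi x @[x --> +oo] --> (0 : R).
Proof.
rewrite (_ : phi = (fun x => normal_peak 1 * expR (- (x ^+ 2 / 2)))); last first.
  by apply/funext => x; rewrite std_normal_pdfE.
rewrite -[X in _ --> X](mulr0 (normal_peak 1)); apply: cvgMr.
apply: (cvg_comp (fun x : R => x ^+ 2 / 2) (fun x => expR (- x))); last first.
  exact: cvgr_expR.
by apply: gt0_cvgMly; [rewrite invr_gt0|exact: cvgr_expr2].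
Qed.

(** Here [- phi] is a primitive of [y * phi y]. *)
Lemma integral_id_std_normal_pdf_right (x : R) : 0 <= x ->
  (\int[leb]_(y in `[x, +oo[) (y * phi y)%:E = (phi x)%:E)%E.
Proof.
move=> x0.
have dphi (y : R) : is_derive y 1 (fun y => - phi y) (y * phi y).
  have d := is_derive_std_normal_pdf y.
  by apply: is_derive_eq; rewrite mulNr opprK.
rewrite (@ge0_continuous_FTC2y _ _ (fun y => - phi y) x 0).
- by rewrite -EFinB opprK add0r.
- by move=> y xy; rewrite mulr_ge0 ?normal_pdf_ge0// (le_trans x0).
- apply: continuous_subspaceT => y; apply: cvgM; first exact: cvg_id.
  exact: continuous_std_normal_pdf.
- by rewrite -[X in _ --> X]oppr0; apply: cvgN; exact: cvg_std_normal_pdf_pinfty.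
- by move=> y _; have [] := dphi y.
- by apply: cvg_at_right_filter; apply: cvgN; exact: continuous_std_normal_pdf.
- by move=> y _; rewrite derive1E; have [_ ->] := dphi y.
Qed.

Lemma integral_id_std_normal_pdf_left (x : R) : x <= 0 ->
  (\int[leb]_(y in `]-oo, x]) (- y * phi y)%:E = (phi x)%:E)%E.
Proof.
move=> x0; rewrite -[x]opprK ge0_integration_by_substitutionNy.
- rewrite std_normal_pdfN -integral_id_std_normal_pdf_right ?oppr_ge0//.
  by apply: eq_integral => y _ /=; rewrite opprK std_normal_pdfN.
- apply: continuous_subspaceT => y; apply: cvgM; last exact: continuous_std_normal_pdf.
  exact: cvgN.
- move=> y; rewrite in_itv/= opprK => yx; rewrite mulr_ge0 ?normal_pdf_ge0//.
  by rewrite oppr_ge0 (le_trans (ltW yx)).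
Qed.

(** A tail on which [`|y| >= `|x|] has the weight [`|x|] absorbed in the integrand,
    and [y * phi y] integrates exactly to [phi x]. *)
Lemma le_Mills (M x : R) (D : set (measurableTypeR R)) (g : R -> R) (s : R -> R) :
  measurable D -> 0 <= M ->
  leb.-integrable setT (EFin \o (fun y => g y * phi y)) ->
  (forall y, `|g y| <= M) -> (forall y, D y -> `|x| <= s y) ->
  (measurable_fun setT s) ->
  (\int[leb]_(y in D) (s y * phi y)%:E = (phi x)%:E)%E ->
  `|x * \int[leb]_(y in D) (g y * phi y)| <= M * phi x.
Proof.
move=> mD M0 ig gM xs ms sE.
have igD := integrableS measurableT mD (@subsetT _ D) ig.
have s0 y : D y -> 0 <= s y by move=> /xs; apply: le_trans.
have mphi : measurable_fun [set: R] phi by exact: measurable_normal_pdf.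
have is_ : leb.-integrable D (fun y => (s y * phi y)%:E).
  apply/integrableP; split.
    by apply/measurable_EFinP/measurable_funTS; exact: measurable_funM.
  apply: le_lt_trans (ltry (phi x)); rewrite -sE le_eqVlt; apply/orP; left.
  apply/eqP; apply: eq_integral => y yD.
  rewrite gee0_abs// lee_fin mulr_ge0 ?normal_pdf_ge0// s0//.
  by rewrite inE in yD.
rewrite -RintegralZl//.
have ixg := integrableZl mD x igD.
apply: le_trans (le_normr_Rintegral mD ixg) _.
have <- : \int[leb]_(y in D) (M * (s y * phi y)) = M * phi x.
  by rewrite RintegralZl//; congr (_ * _); rewrite /Rintegral sE.
apply: le_Rintegral => //; first exact: integrable_norm ixg.
  exact: (integrableZl mD M is_).
move=> y Dy; rewrite normrM normrM (ger0_norm (normal_pdf_ge0 _ _ _)).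
rewrite !mulrA ler_wpM2r ?normal_pdf_ge0// mulrC.
by apply: ler_pM => //; exact: xs.
Qed.

Lemma integrable_bounded (d : measure_display) (T : measurableType d)
    (mu : {finite_measure set T -> \bar R}) (f : T -> R) (M : R) :
  measurable_fun setT f -> (forall x, `|f x| <= M) ->
  mu.-integrable setT (EFin \o f).
Proof.
move=> mf fM; apply: (le_integrable measurableT _ _
  (finite_measure_integrable_cst mu M measurableT)).
- exact/measurable_EFinP.
- by move=> x _; rewrite lee_fin (le_trans (fM x))// ler_norm.
Qed.

(** The solution is [G / phi], where [G] is the primitive of [(h - c) * phi]
    vanishing at minus infinity, for [c] the mean of [h]. As this function has total
    integral [0], [G x] is up to sign also the integral over the right tail;
    estimating on the tail that does not contain the origin bounds [x * f x], hence
    [f']. *)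
Lemma stein_equation_solution (h : R -> R) (M : R) : continuous h ->
  (forall x, `|h x| <= M) ->
  exists f f' : R -> R, exists K : R,
    [/\ forall x : R, is_derive x 1 f (f' x), continuous f',
       forall x, `|f' x| <= K &
       forall x, f' x - x * f x = h x - \int[gam]_y h y].
Proof.
move=> ch hM; set c := \int[gam]_y h y.
pose g x := h x - c; pose K := M + `|c|.
have gK x : `|g x| <= K.
  by apply: le_trans (ler_normB _ _) _; rewrite lerD2r.
have K0 : 0 <= K := le_trans (normr_ge0 _) (gK 0).
have cg : continuous g by move=> x; apply: cvgB; [exact: ch|exact: cvg_cst].
have mh : measurable_fun setT h by exact: continuous_measurable_fun.
have mg : measurable_fun setT g by exact: continuous_measurable_fun.
have ih : gam.-integrable setT (EFin \o h) by apply: (@integrable_bounded _ (measurableTypeR R) gam h M).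
have igg : gam.-integrable setT (EFin \o g) by apply: (@integrable_bounded _ (measurableTypeR R) gam g K).
have ig := integrable_mul_normal_pdf igg.
have g0 : \int[leb]_y (g y * phi y) = 0.
  rewrite -Rintegral_normal// RintegralB//; last first.
    exact: finite_measure_integrable_cst.
  have gamT : gam setT = 1%E by exact: probability_setT.
  by rewrite Rintegral_cst// [X in fine X]gamT mulr1 subrr.
pose G x := \int[leb]_(y in `]-oo, x]) (g y * phi y).
have dG (x : R) : is_derive x 1 G (g x * phi x).
  have [||||dGx <-] := @continuous_FTC1 R (fun y => g y * phi y) -oo%O x (x + 1).
  - by rewrite ltrDl.
  - exact: (integrableS measurableT _ (@subsetT _ _) ig).
  - exact: ltNyr.
  - by apply: cvgM; [exact: cg|exact: continuous_std_normal_pdf].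
  by rewrite derive1E; exact: derivableP.
have phi0 (x : R) : phi x != 0 by rewrite gt_eqF// std_normal_pdf_gt0.
pose f x := G x / phi x; pose f' x := g x + x * f x.
have df (x : R) : is_derive x 1 f (f' x).
  have dGx := dG x; have dphi := is_derive_std_normal_pdf x.
  have dV := is_deriveV (phi0 x) dphi.
  apply: is_derive_eq; rewrite /GRing.scale/= /f' /f.
  by field; exact: phi0.
have cf : continuous f.
  move=> x; apply: differentiable_continuous.
  by apply/derivable1_diffP; have [] := df x.
have xGK x : `|x * G x| <= K * phi x.
  have [x0|x0] := leP x 0.
    apply: (@le_Mills K x `]-oo, x] g (fun y => - y)) => //.
    - by move=> y; rewrite /= in_itv/= => yx; rewrite ler0_norm// lerN2.
    - exact: oppr_measurable.
    - exact: integral_id_std_normal_pdf_left.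
  have GE : G x = - \int[leb]_(y in `]x, +oo[) (g y * phi y).
    have := @Rintegral_itvB R (fun y => g y * phi y) -oo%O +oo%O x.
    rewrite set_itvNyy => /(_ ig isT isT); rewrite [X in X - _]g0 sub0r => <-.
    by rewrite opprK.
  rewrite GE mulrN normrN.
  apply: (@le_Mills K x `]x, +oo[ g id) => //.
  - by move=> y; rewrite /= in_itv/= andbT => /ltW xy; rewrite gtr0_norm.
  - rewrite -integral_id_std_normal_pdf_right ?ltW// integral_itv_obnd_cbnd//.
    apply/measurable_EFinP/measurable_funTS; apply: measurable_funM => //.
    exact: measurable_normal_pdf.
exists f, f', (K + K); split => //.
- move=> x; apply: cvgD; first exact: cg.
  by apply: cvgM; [exact: cvg_id|exact: cf].
- move=> x; apply: le_trans (ler_normD _ _) (lerD (gK x) _).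
  rewrite /f mulrA normrM normfV (ger0_norm (normal_pdf_ge0 _ _ _)).
  by rewrite ler_pdivrMr ?std_normal_pdf_gt0.
- by move=> x; rewrite /f' addrK.
Qed.
End stein.

(** * Integration by parts in one of two independent variables *)

Section freezing.
Context {d : measure_display} {T : measurableType d} {R : realType}
  (P : probability T R) {d2 : measure_display} {S : measurableType d2}.
Notation gam := (normal_prob (0 : R) 1).
Variables (Z : T -> R) (Y : {mfun T >-> S}).
Hypothesis mZ : measurable_fun setT Z.
Hypothesis ZY : forall (A : set (measurableTypeR R)) (B : set S),
  measurable A -> measurable B ->
  P (Z @^-1` A `&` Y @^-1` B) = (gam A * P (Y @^-1` B))%E.

Let law_pair (F : measurableTypeR R * S -> \bar R) :
  measurable_fun setT F -> P.-integrable setT (fun t => F (Z t, Y t)) ->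
  (\int[P]_t F (Z t, Y t) =
   \int[distribution P Y]_y \int[gam]_x F (x, y))%E.
Proof.
move=> mF iF.
have mZY : measurable_fun setT (fun t => (Z t, Y t) : measurableTypeR R * S).
  by apply: measurable_fun_pair => //; exact: mZ.
have lawE (B : set (measurableTypeR R * S)) : measurable B ->
    (gam \x distribution P Y)%E B = pushforward P (fun t => (Z t, Y t)) B.
  move=> mB; apply: (@product_measure_unique _ _ _ _ _ gam (distribution P Y)
    (pushforward P (fun t => (Z t, Y t) : measurableTypeR R * S))) => //.
have -> : (\int[P]_t F (Z t, Y t) =
    \int[pushforward P (fun t => (Z t, Y t) : measurableTypeR R * S)]_z F z)%E.
  by rewrite integral_pushforward.
rewrite (eq_measure_integral (gam \x distribution P Y)%E); last first.
  by move=> B mB _; exact: (esym (lawE B mB)).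
rewrite -integral21_prod_meas1//.
apply/integrableP; split => //.
rewrite (eq_measure_integral (pushforward P (fun t => (Z t, Y t) : measurableTypeR R * S))); last first.
  by move=> B mB _; exact: lawE.
have /integrableP[_] : (pushforward P (fun t => (Z t, Y t) : measurableTypeR R * S)).-integrable setT F.
  exact: integrable_pushforward.
by [].
Qed.

(** By independence the law of [(Z, Y)] is a product, so Fubini's theorem allows
    [gaussian_ibp] to be applied in the first variable for each fixed value of the
    second one. The constant [C] of the growth condition may depend on that
    value, which is what makes the lemma applicable to quadratic forms. *)
Lemma gaussian_ibp_freezing (a a' : R -> S -> R) (C : S -> R) :
  measurable_fun setT (fun z : measurableTypeR R * S => a z.1 z.2) ->
  measurable_fun setT (fun z : measurableTypeR R * S => a' z.1 z.2) ->
  (forall y (x : R), is_derive x 1 (a^~ y) (a' x y)) ->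
  (forall y, continuous (a'^~ y)) ->
  (forall y x, `|a x y| <= C y * expR (x ^+ 2 / 8)) ->
  (forall y x, `|a' x y| <= C y * expR (x ^+ 2 / 8)) ->
  P.-integrable setT (EFin \o (fun t => Z t * a (Z t) (Y t))) ->
  P.-integrable setT (EFin \o (fun t => a' (Z t) (Y t))) ->
  \int[P]_t (Z t * a (Z t) (Y t)) = \int[P]_t a' (Z t) (Y t).
Proof.
move=> ma ma' da ca' aC a'C iza ia'.
have mza : measurable_fun setT
    (fun z : measurableTypeR R * S => z.1 * a z.1 z.2).
  by apply: measurable_funM => //; exact: measurable_fst.
congr fine.
have mza' := (measurable_EFinP _ _).2 mza.
have ma'' := (measurable_EFinP _ _).2 ma'.
rewrite (@law_pair (fun z => (z.1 * a z.1 z.2)%:E))//=.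
rewrite (@law_pair (fun z => (a' z.1 z.2)%:E))//=.
apply: eq_integral => y _.
have [i1 i2 i3] := gaussian_ibp (da y) (ca' y) (aC y) (a'C y).
have := congr1 EFin i3; rewrite /Rintegral fineK; last exact: integrable_fin_num i1.
by rewrite fineK//; exact: integrable_fin_num i2.
Qed.
End freezing.

(** * Independence of one coordinate from all the others *)

Section others.
Context {d : measure_display} {T : measurableType d} {R : realType}
  (P : probability T R) {V : finType} (X : V -> {RV P >-> R}).
Notation gam := (normal_prob (0 : R) 1).
Hypothesis hX : iid_standard_normal X.
Variable i : V.

(** The events determined by the coordinates other than [i] form a pi-system. The
    sigma-algebra it generates makes the sample space itself a value space for the
    remaining coordinates, so that no product space has to be built. *)
Definition other_events : set (set T) :=
  [set B | exists2 A : V -> set R, forall j, measurable (A j) &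
     B = \bigcap_(j in [set j | j != i]) X j @^-1` A j].

Lemma other_events_measurable : other_events `<=` measurable.
Proof.
move=> _ [A mA ->]; apply: fin_bigcap_measurable => [|j _].
  exact: finite_finset.
exact: measurable_funPTI.
Qed.

Lemma other_events_setI_closed : setI_closed other_events.
Proof.
move=> _ _ [A mA ->] [A' mA' ->]; exists (fun j => A j `&` A' j).
  by move=> j; exact: measurableI.
by rewrite -bigcapI; apply: eq_bigcapr => j _; rewrite preimage_setI.
Qed.

Lemma other_eventsT : other_events setT.
Proof.
by exists (fun=> setT) => //; apply/esym/seteqP; split.
Qed.

Lemma preimage_other_events j (A : set R) : j != i -> measurable A ->
  other_events (X j @^-1` A).
Proof.
move=> ji mA; exists (fun k => if k == j then A else setT) => [k|].
  by case: ifP.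
apply/seteqP; split => [t At k _|t /(_ j ji)]; last by rewrite /= eqxx.
by rewrite /=; case: eqP => // ->.
Qed.

Lemma indep_bigcap (A : V -> set R) : (forall j, measurable (A j)) ->
  P (\bigcap_j X j @^-1` A j) = (\prod_(j : V) P (X j @^-1` A j))%E.
Proof.
move=> mA; have [indX _] := hX.
have := indX (index_enum V) A (index_enum_uniq V) mA.
rewrite (_ : [set` index_enum V] = setT) ; first by [].
by apply/seteqP; split => // j _; exact: mem_index_enum.
Qed.

Lemma indep_other_events (A : set R) (B : set T) :
  measurable A -> other_events B ->
  P (B `&` X i @^-1` A) = (gam A * P B)%E.
Proof.
move=> mA [A' mA' ->]; have [_ lawX] := hX.
have bigE (C : set R) : (\bigcap_(j in [set j | j != i]) X j @^-1` A' j) `&` X i @^-1` C =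
    \bigcap_j X j @^-1` (if j == i then C else A' j).
  apply/seteqP; split => [t [At Ct] j _|t At].
    by have [->|ji] := eqVneq j i; [exact: Ct|exact: At].
  split=> [j /= ji|]; first by have := At j I; rewrite /= (negPf ji).
  by have := At i I; rewrite /= eqxx.
have PE (C : set R) : measurable C ->
    P ((\bigcap_(j in [set j | j != i]) X j @^-1` A' j) `&` X i @^-1` C) =
    (gam C * \prod_(j | j != i) P (X j @^-1` A' j))%E.
  move=> mC; rewrite bigE indep_bigcap; last by move=> j; case: ifP.
  rewrite (bigD1 i)//= eqxx -(lawX i C mC); congr (_ * _)%E.
  by apply: eq_bigr => j /negPf ->.
have := PE setT measurableT; rewrite preimage_setT setIT.
rewrite [gam setT]probability_setT mul1e => ->.
exact: PE.
Qed.

(** Mutual independence gives the product formula on the pi-system; both sides are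
    finite measures in [B], so that they agree on the generated sigma-algebra. *)
Lemma indep_other_sigma (A : set R) (B : set T) :
  measurable A -> <<s other_events >> B ->
  P (X i @^-1` A `&` B) = (gam A * P B)%E.
Proof.
move=> mA sB; have mXA : measurable (X i @^-1` A) by exact: measurable_funPTI.
have gamA : gam A \is a fin_num by exact: fin_num_measure.
have g0 : 0 <= fine (gam A) by exact: fine_ge0.
pose m1 := mrestr P mXA; pose m2 := mscale (NngNum g0) P.
have m2E C : m2 C = (gam A * P C)%E by rewrite /m2 /mscale/= fineK.
rewrite setIC -m2E -/(mrestr P mXA B).
apply: (@g_sigma_algebra_measure_unique _ R T other_events
  other_events_measurable (fun=> setT)) => //.
- by move=> _; exact: other_eventsT.
- by apply/seteqP; split => // t _; exists 0%N.
- exact: other_events_setI_closed.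
- by move=> C GC; rewrite [RHS]m2E; exact: indep_other_events.
- move=> _; apply: (le_lt_trans (probability_le1 P _) (ltry 1)).
  exact: measurableI.
Qed.

Definition other_space := g_sigma_algebraType other_events.
Definition to_other_space (t : T) : other_space := t.

Lemma measurable_to_other_space : measurable_fun setT to_other_space.
Proof.
move=> _ B mB; rewrite setTI.
exact: (smallest_sub (@sigma_algebra_measurable _ T) other_events_measurable).
Qed.

HB.instance Definition _ := isMeasurableFun.Build _ _ _ _ to_other_space
  measurable_to_other_space.

Lemma measurable_other_space j : j != i ->
  measurable_fun setT (X j : other_space -> R).
Proof.
move=> ji _ A mA; rewrite setTI; apply: sub_gen_smallest.
exact: preimage_other_events.
Qed.

End others.

(** * Growth estimates and fourth moments *)

Lemma lipschitz_of_derive_bounded {R : realType} (f f' : R -> R) (K : R) :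
  (forall x : R, is_derive x 1 f (f' x)) -> (forall x, `|f' x| <= K) ->
  forall x y, `|f x - f y| <= K * `|x - y|.
Proof.
move=> df f'K.
have cf (a b : R) : {within `[a, b], continuous f}.
  apply: continuous_subspaceT => x; apply: differentiable_continuous.
  by apply/derivable1_diffP; have [] := df x.
have main x y : x <= y -> `|f x - f y| <= K * `|x - y|.
  move=> xy; have [z _ fE] := MVT_segment xy (fun z _ => df z) (cf x y).
  by rewrite distrC fE normrM distrC ler_wpM2r.
move=> x y; have [/main//|/ltW/main] := leP x y.
by rewrite distrC [`|y - x|]distrC.
Qed.

(** The constant is [8 * 129]: [(1 + a) ^+ 4 <= 8 * (1 + a ^+ 4)]. *)
Lemma quartic_growth {R : realType} (x : R) :
  (1 + `|x|) ^+ 4 <= 1032 * expR (x ^+ 2 / 8).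
Proof.
have [e1 _ x4] := expR_sqr_div8_ge x.
have x4E : `|x| ^+ 4 = x ^+ 4 by rewrite -normrX ger0_norm// exprn_even_ge0.
rewrite -x4E in x4; move: x4 e1; set a := `|x|; set e := expR _ => x4 e1.
have h1 : (1 + a) ^+ 2 <= 2 * (1 + a ^+ 2) by have := sqr_ge0 (a - 1); nra.
have h2 : (1 + a ^+ 2) ^+ 2 <= 2 * (1 + a ^+ 4).
  by have := sqr_ge0 (a ^+ 2 - 1); nra.
have : ((1 + a) ^+ 2) ^+ 2 <= (2 * (1 + a ^+ 2)) ^+ 2.
  by rewrite lerXn2r// nnegrE ?sqr_ge0// mulr_ge0// addr_ge0// sqr_ge0.
by rewrite -exprM exprMn; lra.
Qed.

Section expectation_sums.
Context {d : measure_display} {T : measurableType d} {R : realType}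
  (P : probability T R).

Lemma integrable_sumr (I : Type) (s : seq I) (F : I -> T -> R) :
  (forall i, P.-integrable setT (EFin \o F i)) ->
  P.-integrable setT (EFin \o (fun t => \sum_(i <- s) F i t)).
Proof.
move=> iF; elim: s => [|i s IH].
  rewrite (_ : _ \o _ = cst 0%E); last by apply/funext => t; rewrite /= big_nil.
  exact: integrable0.
apply: eq_integrable (integrableD measurableT (iF i) IH) => // t _.
by rewrite /= big_cons.
Qed.

Lemma Rintegral_sumr (I : Type) (s : seq I) (F : I -> T -> R) :
  (forall i, P.-integrable setT (EFin \o F i)) ->
  \int[P]_t (\sum_(i <- s) F i t) = \sum_(i <- s) \int[P]_t F i t.
Proof.
move=> iF; elim: s => [|i s IH].
  rewrite big_nil (@eq_Rintegral _ _ _ _ _ (cst 0)).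
    by rewrite Rintegral_cst// mul0r.
  by move=> t _; rewrite big_nil.
rewrite big_cons -IH -RintegralD//; first last.
  exact: integrable_sumr.
by apply: eq_Rintegral => t _; rewrite big_cons.
Qed.
End expectation_sums.

Section gaussian_moments.
Context {d : measure_display} {T : measurableType d} {R : realType}
  (P : probability T R) {V : finType} (X : V -> {RV P >-> R}).
Notation gam := (normal_prob (0 : R) 1).
Hypothesis hX : iid_standard_normal X.

Lemma integrable_RV_pow4 i : P.-integrable setT (EFin \o (fun t => X i t ^+ 4)).
Proof.
have [_ lawX] := hX.
have mX4 : measurable_fun setT (fun t => X i t ^+ 4) by exact: measurable_funX.
apply/integrableP; split; first exact/measurable_EFinP.
have mpow : measurable_fun [set: R] (fun x => `|(x ^+ 4)%:E|%E).
  by apply: measurableT_comp => //; apply/measurable_EFinP; exact: exprn_measurable.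
have /integrableP[_] : gam.-integrable setT (EFin \o (fun x : R => x ^+ 4)).
  apply: (le_integrable measurableT _ _ (integrableZl measurableT 128 integrable_expR_sqr_div4)).
    by apply/measurable_EFinP; exact: exprn_measurable.
  move=> x _; rewrite lee_fin ger0_norm ?exprn_even_ge0// ger0_norm ?mulr_ge0 ?expR_ge0//.
  have [_ _ /le_trans] := expR_sqr_div8_ge x; apply.
  by rewrite ler_wpM2l// ler_expR ler_wpM2l ?sqr_ge0// lef_pV2 ?posrE// ler_nat.
have mXi : measurable_fun setT (X i : T -> measurableTypeR R).
  exact: (measurable_funP (X i)).
apply: le_lt_trans; rewrite -(@ge0_integral_pushforward _ _ T (measurableTypeR R) R (X i) mXi P setT
  (fun x => `|(x ^+ 4)%:E|%E))//.
rewrite le_eqVlt; apply/orP; left; apply/eqP.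
by apply: eq_measure_integral => A mA _; exact: (lawX i A mA).
Qed.
End gaussian_moments.

(** * Integration by parts for a quadratic form, coordinate by coordinate *)

Lemma measurable_sum_cond {d : measure_display} {S : measurableType d}
    {R : realType} (I : Type) (s : seq I) (p : pred I) (F : I -> S -> R) :
  (forall i, p i -> measurable_fun setT (F i)) ->
  measurable_fun setT (fun x => \sum_(i <- s | p i) F i x).
Proof.
move=> mF; rewrite (_ : (fun _ => _) =
    (fun x => \sum_(i <- s) if p i then F i x else 0)).
  by apply: measurable_sum => i; case pi : (p i) => //; exact: mF.
by apply/funext => x; rewrite big_mkcond.
Qed.

Section quad.
Context {d : measure_display} {T : measurableType d} {R : realType}
  (P : probability T R) {V : finType} (X : V -> {RV P >-> R}).
Hypothesis hX : iid_standard_normal X.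
Implicit Type M : V -> V -> R.

(** A single random variable dominating all the coordinates; every integrability
    claim on quadratic forms reduces to that of its fourth power. *)
Definition envelope t : R := 1 + \sum_j `|X j t|.

Lemma envelope_ge1 t : 1 <= envelope t.
Proof. by rewrite lerDl sumr_ge0. Qed.

Lemma le_envelope j t : `|X j t| <= envelope t.
Proof.
rewrite /envelope (bigD1 j)//= addrCA lerDl addr_ge0//.
by rewrite sumr_ge0.
Qed.

Lemma integrable_envelope_pow4 :
  P.-integrable setT (EFin \o (fun t => envelope t ^+ 4)).
Proof.
rewrite /envelope; elim: (index_enum V) => [|j s IH].
  rewrite (_ : _ \o _ = cst 1%E); last first.
    by apply/funext => t; rewrite /= big_nil addr0 expr1n.
  exact: finite_measure_integrable_cst.
have iS := integrableD measurableT IH (integrable_RV_pow4 hX j).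
apply: (le_integrable measurableT _ _ (integrableZl measurableT 8 iS)).
  apply/measurable_EFinP; apply: measurable_funX; apply: measurable_funD => //.
  apply: measurable_sum => k; apply: measurableT_comp => //.
move=> t _; rewrite lee_fin big_cons.
set a := \sum_(k <- s) _; set b := X j t.
have a0 : 0 <= a by rewrite sumr_ge0.
have b4 : b ^+ 4 = `|b| ^+ 4 by rewrite -normrX ger0_norm// exprn_even_ge0.
rewrite /= b4 ger0_norm; last by rewrite exprn_ge0// addr_ge0// addr_ge0.
rewrite [leRHS]ger0_norm; last by rewrite mulr_ge0// addr_ge0// exprn_ge0// addr_ge0.
rewrite addrCA addrC; move: (normr_ge0 b); set c := `|b|; set e := 1 + a => c0.
have e0 : 0 <= e by rewrite addr_ge0.
have h1 : (e + c) ^+ 2 <= 2 * (e ^+ 2 + c ^+ 2) by have := sqr_ge0 (e - c); nra.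
have h2 : (e ^+ 2 + c ^+ 2) ^+ 2 <= 2 * (e ^+ 4 + c ^+ 4).
  by have := sqr_ge0 (e ^+ 2 - c ^+ 2); nra.
have : ((e + c) ^+ 2) ^+ 2 <= (2 * (e ^+ 2 + c ^+ 2)) ^+ 2.
  by rewrite lerXn2r// nnegrE ?sqr_ge0// mulr_ge0// addr_ge0// sqr_ge0.
by rewrite -exprM exprMn; lra.
Qed.

Lemma integrable_quartic (F : T -> R) (C : R) : measurable_fun setT F ->
  (forall t, `|F t| <= C * envelope t ^+ 4) -> P.-integrable setT (EFin \o F).
Proof.
move=> mF FC.
apply: (le_integrable measurableT _ _ (integrableZl measurableT C integrable_envelope_pow4)).
  exact/measurable_EFinP.
by move=> t _; rewrite lee_fin; apply: le_trans (FC t) (ler_norm _).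
Qed.

Definition lin_form M i t : R := \sum_j M i j * X j t.
Definition quad_form M t : R := \sum_i X i t * lin_form M i t.
Definition entry_norm M : R := \sum_i \sum_j `|M i j|.

Lemma measurable_lin_form M i : measurable_fun setT (lin_form M i).
Proof. by apply: measurable_sum => j; exact: measurable_funM. Qed.

Lemma measurable_quad_form M : measurable_fun setT (quad_form M).
Proof.
apply: measurable_sum => j; apply: measurable_funM => //.
exact: measurable_lin_form.
Qed.

Lemma entry_norm_ge0 M : 0 <= entry_norm M.
Proof. by apply: sumr_ge0 => i _; exact: sumr_ge0. Qed.

Lemma lin_form_row_bound M i t :
  `|lin_form M i t| <= (\sum_j `|M i j|) * envelope t.
Proof.
apply: le_trans (ler_norm_sum _ _ _) _; rewrite mulr_suml.
by apply: ler_sum => j _; rewrite normrM ler_wpM2l// le_envelope.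
Qed.

Lemma lin_form_bound M i t : `|lin_form M i t| <= entry_norm M * envelope t.
Proof.
apply: le_trans (lin_form_row_bound M i t) _.
rewrite ler_wpM2r//; first exact: le_trans ler01 (envelope_ge1 t).
by rewrite /entry_norm [leRHS](bigD1 i)//= lerDl sumr_ge0// => k _; rewrite sumr_ge0.
Qed.

Lemma quad_form_bound M t : `|quad_form M t| <= entry_norm M * envelope t ^+ 2.
Proof.
apply: le_trans (ler_norm_sum _ _ _) _; rewrite mulr_suml.
apply: ler_sum => i _; rewrite normrM expr2 mulrA mulrC.
by apply: ler_pM => //; [exact: lin_form_row_bound|exact: le_envelope].
Qed.

Section coordinate.
Variables (M : V -> V -> R) (i : V).
Hypothesis symM : forall j k, M j k = M k j.

(** Together with [rest_form], the part of the quadratic form which does not involve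
    the [i]-th variable: [quad_form M] is a polynomial of degree two in [X i] with
    coefficients [M i i], [2 * cross_form] and [rest_form]. *)
Definition cross_form (t : T) : R := \sum_(j | j != i) M i j * X j t.
Definition rest_form (t : T) : R :=
  \sum_(j | j != i) X j t * \sum_(k | k != i) M j k * X k t.

Lemma lin_form_split t : lin_form M i t = M i i * X i t + cross_form t.
Proof. by rewrite /lin_form (bigD1 i). Qed.

Lemma quad_form_split t : quad_form M t =
  M i i * X i t ^+ 2 + 2 * X i t * cross_form t + rest_form t.
Proof.
rewrite /quad_form (bigD1 i)//= lin_form_split.
have -> : \sum_(j | j != i) X j t * lin_form M j t =
    X i t * cross_form t + rest_form t.
  rewrite /cross_form /rest_form mulr_sumr -big_split/=; apply: eq_bigr => j ji.
  by rewrite /lin_form (bigD1 i)//= (symM j i); ring.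
ring.
Qed.

Lemma measurable_cross_form :
  measurable_fun setT (cross_form : other_space X i -> R).
Proof.
apply: measurable_sum_cond => j ji; apply: measurable_funM => //.
exact: measurable_other_space.
Qed.

Lemma measurable_rest_form :
  measurable_fun setT (rest_form : other_space X i -> R).
Proof.
apply: measurable_sum_cond => j ji; apply: measurable_funM.
  exact: measurable_other_space.
apply: measurable_sum_cond => k ki; apply: measurable_funM => //.
exact: measurable_other_space.
Qed.

Section ibp.
Variables (f f' : R -> R) (K : R).
Hypothesis df : forall x : R, is_derive x 1 f (f' x).
Hypothesis cf' : continuous f'.
Hypothesis f'K : forall x, `|f' x| <= K.

Let K0 : 0 <= K := le_trans (normr_ge0 _) (f'K 0).

Let fK y : `|f y| <= `|f 0| + K * `|y|.
Proof.
have := lipschitz_of_derive_bounded df f'K y 0; rewrite subr0 => h.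
by rewrite -[f y](subrK (f 0)) (le_trans (ler_normD _ _))// addrC lerD2l.
Qed.

(** The function [lin_form M i * f (quad_form M)] of the [i]-th variable [x], the other
    coordinates being fixed, and [a'] its derivative. *)
Let a (x : R) (t : other_space X i) : R :=
  (M i i * x + cross_form t) *
  f (M i i * x ^+ 2 + 2 * x * cross_form t + rest_form t).
Let a' (x : R) (t : other_space X i) : R :=
  M i i * f (M i i * x ^+ 2 + 2 * x * cross_form t + rest_form t) +
  2 * (M i i * x + cross_form t) ^+ 2 *
  f' (M i i * x ^+ 2 + 2 * x * cross_form t + rest_form t).

Let cf : continuous f.
Proof.
move=> x; apply: differentiable_continuous.
by apply/derivable1_diffP; have [] := df x.
Qed.

Let da t (x : R) : is_derive x 1 (a^~ t) (a' x t).
Proof.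
rewrite /a /a'; set m := M i i; set U := cross_form t; set W := rest_form t.
have dq : is_derive x 1 (fun x : R => m * x ^+ 2 + 2 * x * U + W)
    (2 * (m * x + U)).
  by apply: is_derive_eq; rewrite /GRing.scale/=; ring.
have dfq := @is_derive1_comp R f (fun x : R => m * x ^+ 2 + 2 * x * U + W)
    x _ _ (df _) dq.
have dl : is_derive x 1 (fun x : R => m * x + U) m.
  by apply: is_derive_eq; rewrite /GRing.scale/=; ring.
apply: (is_derive_eq (is_deriveM dl dfq)).
by rewrite /GRing.scale/=; ring.
Qed.

Let ca' t : continuous (a'^~ t).
Proof.
move=> x; rewrite /a'; set m := M i i; set U := cross_form t; set W := rest_form t.
have cl : {for x, continuous (fun x : R => m * x + U)}.
  by apply: cvgD; [apply: cvgM; [exact: cvg_cst|exact: cvg_id]|exact: cvg_cst].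
pose q (x : R) := m * x ^+ 2 + 2 * x * U + W.
have cq : {for x, continuous q}.
  apply: cvgD; last exact: cvg_cst.
  apply: cvgD; first by apply: cvgM; [exact: cvg_cst|exact: exprn_continuous].
  by apply: cvgM; [apply: cvgM; [exact: cvg_cst|exact: cvg_id]|exact: cvg_cst].
have cfq : {for x, continuous (f \o q)} by apply: continuous_comp; [exact: cq|exact: cf].
have cfq' : {for x, continuous (f' \o q)} by apply: continuous_comp; [exact: cq|exact: cf'].
have cl2 : {for x, continuous ((fun y : R => y ^+ 2) \o (fun x : R => m * x + U))}.
  by apply: continuous_comp; [exact: cl|exact: exprn_continuous].
apply: cvgD; first by apply: cvgM; [exact: cvg_cst|exact: cfq].
apply: cvgM; last exact: cfq'.
by apply: cvgM; [exact: cvg_cst|exact: cl2].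
Qed.

(** [slope] and [height] are the coefficients of bounds in powers of [1 + `|x|], for
    the linear factor and for the composition of [f] with the quadratic polynomial. *)
Let slope t := `|M i i| + `|cross_form t|.
Let height t := `|f 0| + K * (`|M i i| + 2 * `|cross_form t| + `|rest_form t|).
Let bulk t := slope t * height t + `|M i i| * height t + 2 * slope t ^+ 2 * K.
Let C t := 1032 * bulk t.

Let slope_ge0 t : 0 <= slope t. Proof. by rewrite addr_ge0. Qed.

Let height_ge0 t : 0 <= height t.
Proof. by rewrite addr_ge0// mulr_ge0// !addr_ge0// mulr_ge0. Qed.

Let slopeP t x : `|M i i * x + cross_form t| <= slope t * (1 + `|x|).
Proof.
apply: le_trans (ler_normD _ _) _; rewrite normrM /slope.
by have := normr_ge0 x; have := normr_ge0 (M i i); have := normr_ge0 (cross_form t);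
  set u := `|x|; set v := `|M i i|; set w := `|cross_form t| => *; nra.
Qed.

Let heightP t x : `|f (M i i * x ^+ 2 + 2 * x * cross_form t + rest_form t)| <=
  height t * (1 + `|x|) ^+ 2.
Proof.
apply: le_trans (fK _) _; rewrite /height [leRHS]mulrDl lerD//.
  by rewrite ler_peMr// expr_ge1// lerDl.
rewrite -[leRHS]mulrA ler_wpM2l//.
apply: le_trans (ler_normD _ _) _.
apply: le_trans (lerD (ler_normD _ _) (lexx _)) _.
have -> : `|M i i * x ^+ 2| = `|M i i| * `|x| ^+ 2 by rewrite normrM normrX.
have -> : `|2 * x * cross_form t| = 2 * `|x| * `|cross_form t|.
  by rewrite !normrM ger0_norm.
by have := normr_ge0 x; have := normr_ge0 (M i i); have := normr_ge0 (cross_form t);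
  have := normr_ge0 (rest_form t);
  set u := `|x|; set v := `|M i i|; set w := `|cross_form t|;
  set z := `|rest_form t| => z0 w0 v0 u0;
  have := mulr_ge0 v0 u0; have := mulr_ge0 w0 u0; have := mulr_ge0 z0 u0;
  have := mulr_ge0 z0 (sqr_ge0 u); have := mulr_ge0 w0 (sqr_ge0 u); nra.
Qed.

Let growth (c x : R) (n : nat) : (n <= 4)%N -> 0 <= c ->
  c * (1 + `|x|) ^+ n <= 1032 * c * expR (x ^+ 2 / 8).
Proof.
move=> n4 c0; rewrite -mulrA mulrCA ler_wpM2l// (le_trans _ (quartic_growth x))//.
by rewrite ler_weXn2l// lerDl.
Qed.

Let aC t x : `|a x t| <= C t * expR (x ^+ 2 / 8).
Proof.
rewrite normrM; apply: le_trans (ler_pM _ _ (slopeP t x) (heightP t x)) _ => //.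
rewrite mulrACA -exprS (le_trans (growth _ _ _))//; first exact: mulr_ge0.
have h : slope t * height t <= bulk t.
  rewrite /bulk -addrA lerDl addr_ge0//; first exact: mulr_ge0.
  by rewrite mulr_ge0// mulr_ge0// sqr_ge0.
exact: (ler_wpM2r (expR_ge0 _) (ler_wpM2l (ler0n R 1032) h)).
Qed.

Let a'C t x : `|a' x t| <= C t * expR (x ^+ 2 / 8).
Proof.
apply: (@le_trans _ _ ((`|M i i| * height t + 2 * slope t ^+ 2 * K) * (1 + `|x|) ^+ 2)).
  apply: le_trans (ler_normD _ _) _; rewrite [leRHS]mulrDl lerD//.
    by rewrite normrM -[leRHS]mulrA ler_wpM2l.
  rewrite normrM normrM (ger0_norm (_ : 0 <= 2))// normrX.
  rewrite [leRHS](_ : _ = 2 * (slope t * (1 + `|x|)) ^+ 2 * K); last by ring.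
  rewrite ler_pM// ?mulr_ge0 ?exprn_ge0// ler_wpM2l//.
  by rewrite lerXn2r// nnegrE mulr_ge0// addr_ge0.
have pos : 0 <= `|M i i| * height t + 2 * slope t ^+ 2 * K.
  by rewrite addr_ge0 ?mulr_ge0// sqr_ge0.
rewrite (le_trans (growth _ _ pos))//.
have h : `|M i i| * height t + 2 * slope t ^+ 2 * K <= bulk t.
  by rewrite /bulk -addrA lerDr mulr_ge0.
exact: (ler_wpM2r (expR_ge0 _) (ler_wpM2l (ler0n R 1032) h)).
Qed.

Let pt := (measurableTypeR R * other_space X i)%type.

Let mx : measurable_fun setT (fun z : pt => z.1 : R).
Proof. exact: measurable_fst. Qed.

Let mU : measurable_fun setT (fun z : pt => cross_form z.2).
Proof. by apply: (measurableT_comp measurable_cross_form); exact: measurable_snd. Qed.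

Let mW : measurable_fun setT (fun z : pt => rest_form z.2).
Proof. by apply: (measurableT_comp measurable_rest_form); exact: measurable_snd. Qed.

Let ml : measurable_fun setT (fun z : pt => M i i * z.1 + cross_form z.2 : R).
Proof. by apply: measurable_funD => //; exact: measurable_funM. Qed.

Let mq : measurable_fun setT (fun z : pt =>
  M i i * z.1 ^+ 2 + 2 * z.1 * cross_form z.2 + rest_form z.2 : R).
Proof.
apply: measurable_funD => //; apply: measurable_funD.
  by apply: measurable_funM => //; exact: measurable_funX.
by apply: measurable_funM => //; exact: measurable_funM.
Qed.

Let mf : measurable_fun setT f. Proof. exact: continuous_measurable_fun. Qed.
Let mf' : measurable_fun setT f'. Proof. exact: continuous_measurable_fun. Qed.

Let ma : measurable_fun setT (fun z : pt => a z.1 z.2).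
Proof. by apply: measurable_funM => //; exact: (measurableT_comp mf mq). Qed.

Let ma' : measurable_fun setT (fun z : pt => a' z.1 z.2).
Proof.
apply: measurable_funD.
  by apply: measurable_funM => //; exact: (measurableT_comp mf mq).
apply: measurable_funM; last exact: (measurableT_comp mf' mq).
by apply: measurable_funM => //; exact: measurable_funX.
Qed.

Lemma integrable_f_quad_form :
  P.-integrable setT (EFin \o (fun t => f (quad_form M t))).
Proof.
apply: (@integrable_quartic _ (`|f 0| + K * entry_norm M)).
  exact: (measurableT_comp mf (measurable_quad_form M)).
move=> t; apply: le_trans (fK _) _.
have N1 := envelope_ge1 t; rewrite mulrDl lerD//.
  by rewrite ler_peMr// exprn_ege1.
rewrite -mulrA ler_wpM2l// (le_trans (quad_form_bound _ _))//.
by rewrite ler_wpM2l ?entry_norm_ge0// ler_weXn2l.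
Qed.

Lemma integrable_lin_sqr_f'_quad_form :
  P.-integrable setT (EFin \o (fun t => lin_form M i t ^+ 2 * f' (quad_form M t))).
Proof.
apply: (@integrable_quartic _ (entry_norm M ^+ 2 * K)).
  apply: measurable_funM; last exact: (measurableT_comp mf' (measurable_quad_form M)).
  by apply: measurable_funX; exact: measurable_lin_form.
move=> t; have N1 := envelope_ge1 t; rewrite normrM normrX.
rewrite [leRHS](_ : _ = (entry_norm M ^+ 2 * envelope t ^+ 4) * K); last by ring.
apply: ler_pM => //.
apply: (@le_trans _ _ ((entry_norm M * envelope t) ^+ 2)).
  rewrite lerXn2r// ?nnegrE ?lin_form_bound// mulr_ge0 ?entry_norm_ge0//.
  exact: le_trans N1.
by rewrite exprMn ler_wpM2l ?sqr_ge0// ler_weXn2l.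
Qed.

Lemma integrable_coord_lin_f_quad_form : P.-integrable setT
  (EFin \o (fun t => X i t * (lin_form M i t * f (quad_form M t)))).
Proof.
apply: (@integrable_quartic _ (entry_norm M * (`|f 0| + K * entry_norm M))).
  apply: measurable_funM => //; apply: measurable_funM; first exact: measurable_lin_form.
  exact: (measurableT_comp mf (measurable_quad_form M)).
move=> t; have N1 := envelope_ge1 t; have E0 := entry_norm_ge0 M.
rewrite [leRHS](_ : _ = envelope t * ((entry_norm M * envelope t) *
  ((`|f 0| + K * entry_norm M) * envelope t ^+ 2))); last by ring.
rewrite !normrM ler_pM ?le_envelope// ler_pM ?lin_form_bound//.
apply: le_trans (fK _) _; rewrite mulrDl lerD//.
  by rewrite ler_peMr// exprn_ege1.
by rewrite -mulrA ler_wpM2l// quad_form_bound.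
Qed.

(** The derivative of [quad_form M] in the [i]-th variable is [2 * lin_form M i], and
    that of [lin_form M i] is [M i i]. *)
Lemma gaussian_ibp_coordinate :
  \int[P]_t (X i t * (lin_form M i t * f (quad_form M t))) =
  M i i * \int[P]_t f (quad_form M t) +
  2 * \int[P]_t (lin_form M i t ^+ 2 * f' (quad_form M t)).
Proof.
have i1 := integrable_f_quad_form; have i2 := integrable_lin_sqr_f'_quad_form.
have Mi1 := integrableZl measurableT (M i i) i1.
have Mi2 := integrableZl measurableT 2 i2.
rewrite -!RintegralZl// -RintegralD//.
have aE t : a (X i t) t = lin_form M i t * f (quad_form M t).
  by rewrite /a -lin_form_split -quad_form_split.
have a'E t : a' (X i t) t =
    M i i * f (quad_form M t) + 2 * (lin_form M i t ^+ 2 * f' (quad_form M t)).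
  by rewrite /a' -lin_form_split -quad_form_split mulrA.
have mZ : measurable_fun setT (X i) by exact: (measurable_funP (X i)).
have ZY (A : set (measurableTypeR R)) (B : set (other_space X i)) :
    measurable A -> measurable B ->
    P (X i @^-1` A `&` to_other_space X i @^-1` B) =
    (normal_prob 0 1 A * P (to_other_space X i @^-1` B))%E.
  by move=> mA mB; exact: indep_other_sigma.
have E1 : \int[P]_t (X i t * (lin_form M i t * f (quad_form M t))) =
    \int[P]_t (X i t * a (X i t) (to_other_space X i t)).
  by apply: eq_Rintegral => t _; rewrite -aE.
have E2 : \int[P]_t (M i i * f (quad_form M t) +
      2 * (lin_form M i t ^+ 2 * f' (quad_form M t))) =
    \int[P]_t a' (X i t) (to_other_space X i t).
  by apply: eq_Rintegral => t _; rewrite -a'E.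
rewrite E1 E2; apply: (@gaussian_ibp_freezing _ _ _ P _ _ (X i)
  (to_other_space X i : {mfun T >-> other_space X i}) mZ ZY a a' C) => //.
- by apply: eq_integrable integrable_coord_lin_f_quad_form => // t _; rewrite /= -aE.
- apply: eq_integrable (integrableD measurableT Mi1 Mi2) => // t _.
  by rewrite /= -EFinM -EFinM -EFinD -a'E.
Qed.
End ibp.
End coordinate.
End quad.

(** * Mean and variance of a quadratic form *)

Section quad2.
Context {d : measure_display} {T : measurableType d} {R : realType}
  (P : probability T R) {V : finType} (X : V -> {RV P >-> R}).
Hypothesis hX : iid_standard_normal X.
Implicit Type M : V -> V -> R.

Definition lin_sqr_sum M t : R := \sum_i lin_form X M i t ^+ 2.

(** Euler's identity [quad_form M = \sum_i X i * lin_form M i] allows integration by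
    parts in each coordinate separately. *)
Lemma gaussian_ibp_quad_form M (f f' : R -> R) (K : R) :
  (forall j k, M j k = M k j) ->
  (forall x : R, is_derive x 1 f (f' x)) -> continuous f' ->
  (forall x, `|f' x| <= K) ->
  [/\ P.-integrable setT (EFin \o (fun t => quad_form X M t * f (quad_form X M t))),
      P.-integrable setT (EFin \o (fun t => f (quad_form X M t))),
      P.-integrable setT (EFin \o (fun t => lin_sqr_sum M t * f' (quad_form X M t))) &
      \int[P]_t (quad_form X M t * f (quad_form X M t)) =
      (\sum_i M i i) * \int[P]_t f (quad_form X M t) +
      2 * \int[P]_t (lin_sqr_sum M t * f' (quad_form X M t))].
Proof.
move=> symM df cf' f'K.
have QE t : quad_form X M t * f (quad_form X M t) =
    \sum_i X i t * (lin_form X M i t * f (quad_form X M t)).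
  by rewrite mulr_suml; apply: eq_bigr => i _; rewrite mulrA.
have LE t : lin_sqr_sum M t * f' (quad_form X M t) =
    \sum_i lin_form X M i t ^+ 2 * f' (quad_form X M t) by rewrite mulr_suml.
have i1 i := integrable_coord_lin_f_quad_form hX M i df f'K.
have i2 := integrable_f_quad_form hX M df f'K.
have i3 i := integrable_lin_sqr_f'_quad_form hX M i cf' f'K.
split => //.
- by apply: eq_integrable (integrable_sumr (index_enum V) i1) => // t _; rewrite /= QE.
- by apply: eq_integrable (integrable_sumr (index_enum V) i3) => // t _; rewrite /= LE.
rewrite (@eq_Rintegral _ _ _ _ _ (fun t => \sum_i X i t * (lin_form X M i t * f (quad_form X M t)))); last first.
  by move=> t _; rewrite QE.
rewrite Rintegral_sumr// [X in _ + 2 * X](@eq_Rintegral _ _ _ _ _ (fun t => \sum_i lin_form X M i t ^+ 2 * f' (quad_form X M t))); last first.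
  by move=> t _; rewrite LE.
rewrite Rintegral_sumr// mulr_suml mulr_sumr -big_split/=.
by apply: eq_bigr => i _; rewrite (gaussian_ibp_coordinate hX i symM df cf' f'K).
Qed.

Definition sqr_matrix M i j : R := \sum_k M i k * M k j.

Lemma sqr_matrix_sym M : (forall j k, M j k = M k j) ->
  forall j k, sqr_matrix M j k = sqr_matrix M k j.
Proof.
by move=> symM j k; apply: eq_bigr => l _; rewrite mulrC (symM l k) (symM j l).
Qed.

(** In matrix notation, [|M X|^2 = X^T M^2 X] for a symmetric [M]. *)
Lemma lin_sqr_sumE M t : (forall j k, M j k = M k j) ->
  lin_sqr_sum M t = quad_form X (sqr_matrix M) t.
Proof.
move=> symM; rewrite /lin_sqr_sum /quad_form /lin_form.
under eq_bigr do rewrite expr2 mulr_suml.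
rewrite exchange_big/=; apply: eq_bigr => j _.
under eq_bigr do rewrite mulr_sumr.
rewrite exchange_big/= mulr_sumr; apply: eq_bigr => k _.
rewrite /sqr_matrix mulr_suml mulr_sumr; apply: eq_bigr => i _.
by rewrite (symM i j); ring.
Qed.

(** The integration by parts formula for the constant function [1]. *)
Lemma expectation_quad_form M : (forall j k, M j k = M k j) ->
  P.-integrable setT (EFin \o quad_form X M) /\
  \int[P]_t quad_form X M t = \sum_i M i i.
Proof.
move=> symM.
have [||i1 i2 _] := @gaussian_ibp_quad_form M (fun=> 1) (fun=> 0) 0 symM.
- by move=> x; exact: cvg_cst.
- by move=> x; rewrite normr0.
under eq_Rintegral do rewrite mulr1.
under [X in _ = _ + 2 * X]eq_Rintegral do rewrite mulr0.
have PT : fine (P setT) = 1 by rewrite [P setT]probability_setT.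
rewrite !Rintegral_cst// !PT mul0r mulr0 addr0 mul1r mulr1 => ->.
by split => //; apply: eq_integrable i1 => // t _; rewrite /= mulr1.
Qed.

(** The integration by parts formula for the function [x - tr M], whose mean along the quadratic form is
    [0], combined with the mean of the quadratic form of [M ^ 2]. *)
Lemma variance_quad_form M : (forall j k, M j k = M k j) ->
  P.-integrable setT (EFin \o (fun t => (quad_form X M t - \sum_i M i i) ^+ 2)) /\
  \int[P]_t (quad_form X M t - \sum_i M i i) ^+ 2 = 2 * \sum_i sqr_matrix M i i.
Proof.
move=> symM; set tr := \sum_i M i i.
have [|||i1 i2 i3 E] := @gaussian_ibp_quad_form M (fun x => x - tr) (fun=> 1) 1 symM.
- by move=> x; apply: is_derive_eq; rewrite subr0.
- by move=> x; exact: cvg_cst.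
- by move=> x; rewrite normr1.
have [iQ EQ] := expectation_quad_form symM.
have [_ EM2] := expectation_quad_form (sqr_matrix_sym symM).
have itr := integrableZl measurableT tr i2.
have E0 : \int[P]_t (quad_form X M t - tr) = 0.
  rewrite RintegralB//; last exact: finite_measure_integrable_cst.
  by rewrite EQ Rintegral_cst// [X in _ - tr * fine X]probability_setT mulr1 subrr.
have sqE t : (quad_form X M t - tr) ^+ 2 =
  quad_form X M t * (quad_form X M t - tr) - tr * (quad_form X M t - tr).
  by rewrite expr2 mulrBl.
split.
  by apply: eq_integrable (integrableB measurableT i1 itr) => // t _; rewrite /= sqE.
under eq_Rintegral do rewrite sqE.
rewrite RintegralB// RintegralZl// E0 E E0 !mulr0 subr0 add0r; congr (_ * _).
rewrite -EM2; apply: eq_Rintegral => t _.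
by rewrite mulr1 lin_sqr_sumE.
Qed.
End quad2.

(** * Convergence in distribution from continuous test functions *)

Section ramp.
Context {R : realType}.
Implicit Types x e y : R.

(** A continuous approximation of the indicator of [`]-oo, x]], with slope on
    [[x, x + e]]. *)
Definition ramp x e y : R := Num.max 0 (Num.min 1 ((x + e - y) / e)).

Lemma ramp_ge0 x e y : 0 <= ramp x e y.
Proof. by rewrite le_max lexx. Qed.

Lemma ramp_le1 x e y : ramp x e y <= 1.
Proof. by rewrite ge_max ler01 ge_min lexx. Qed.

Lemma ramp_norm_le1 x e y : `|ramp x e y| <= 1.
Proof. by rewrite ger0_norm ?ramp_ge0// ramp_le1. Qed.

Lemma ramp_eq1 x e y : 0 < e -> y <= x -> ramp x e y = 1.
Proof.
move=> e0 yx; rewrite /ramp min_l ?max_r//.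
by rewrite ler_pdivlMr// mul1r; lra.
Qed.

Lemma ramp_eq0 x e y : 0 < e -> x + e <= y -> ramp x e y = 0.
Proof.
move=> e0 yx; rewrite /ramp max_l// ge_min; apply/orP; right.
by rewrite pmulr_lle0 ?invr_gt0//; lra.
Qed.

Lemma continuous_ramp x e : continuous (ramp x e).
Proof.
move=> y; apply: (@continuous_max _ _ (cst 0) (fun y => Num.min 1 ((x + e - y) / e))).
  exact: cvg_cst.
apply: (@continuous_min _ _ (cst 1) (fun y => (x + e - y) / e)); first exact: cvg_cst.
by apply: cvgM; [apply: cvgB; [exact: cvg_cst|exact: cvg_id]|exact: cvg_cst].
Qed.

Lemma measurable_ramp x e : measurable_fun setT (ramp x e).
Proof. by apply: continuous_measurable_fun; exact: continuous_ramp. Qed.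

Lemma ramp_sandwich (d : measure_display) (S : measurableType d)
    (Q : probability S R) (Z : S -> R) x e : measurable_fun setT Z -> 0 < e ->
  fine (Q (Z @^-1` `]-oo, x])) <= \int[Q]_t ramp x e (Z t) /\
  \int[Q]_t ramp x e (Z t) <= fine (Q (Z @^-1` `]-oo, x + e])).
Proof.
move=> mZ e0.
have mS z : measurable (Z @^-1` `]-oo, z]).
  by rewrite -[X in measurable X]setTI; exact: mZ.
have indE z : fine (Q (Z @^-1` `]-oo, z])) = \int[Q]_t \1_(Z @^-1` `]-oo, z]) t.
  by rewrite /Rintegral integral_indic// setIT.
have iind z : Q.-integrable setT (EFin \o \1_(Z @^-1` `]-oo, z])).
  apply: (@integrable_bounded _ _ _ _ _ 1); first exact: measurable_indic.
  by move=> t; rewrite indicE; case: (_ \in _); rewrite ?normr1 ?normr0.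
have iramp : Q.-integrable setT (EFin \o (fun t => ramp x e (Z t))).
  apply: (@integrable_bounded _ _ _ _ _ 1); last by move=> t; exact: ramp_norm_le1.
  exact: (measurableT_comp (measurable_ramp x e) mZ).
split; rewrite indE; apply: le_Rintegral => // t _; rewrite indicE.
  have [|_] := boolP (t \in _); last exact: ramp_ge0.
  by rewrite inE/= in_itv/= => Zx; rewrite ramp_eq1.
have [_|] := boolP (t \in _); first exact: ramp_le1.
rewrite notin_setE/= in_itv/= => /negP; rewrite -ltNge => /ltW ?.
by rewrite ramp_eq0.
Qed.
End ramp.

(** Ramps ending at [x] and starting at [x] enclose the distribution function at [x]
    between values of the limit at nearby points; continuity at [x] closes the
    gap. *)
Lemma cvg_in_distribution_continuous_bounded (d : measure_display)
    (T : measurableType d) (R : realType) (P : probability T R)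
    (Y : nat -> {RV P >-> R}) (mu : probability (measurableTypeR R) R) :
  (forall h : R -> R, continuous h -> (forall x, `|h x| <= 1) ->
    \int[P]_t h (Y n t) @[n --> \oo] --> \int[mu]_x h x) ->
  cvg_in_distribution Y mu.
Proof.
move=> hY x cx.
pose Phi r := fine (mu `]-oo, r]%classic).
have PhiE r : mu `]-oo, r]%classic = (Phi r)%:E by rewrite fineK// fin_num_measure.
pose G n := fine (P (Y n @^-1` `]-oo, x])).
have GE n : cdf (Y n) x = (G n)%:E.
  by rewrite fineK//; apply: fin_num_measure; exact: measurable_funPTI.
have cPhi : {for x, continuous Phi}.
  have /fine_cvg : mu `]-oo, r]%classic @[r --> x] --> (Phi x)%:E by rewrite -PhiE; exact: cx.
  by [].
rewrite PhiE; under eq_fun do rewrite GE.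
apply: cvg_EFin; first exact: nearW.
apply/cvgrPdist_le => eta eta0.
have eta2 : 0 < eta / 2 by rewrite divr_gt0.
move/cvgrPdist_le : cPhi => /(_ _ eta2)[e /= e0 Phie].
pose c := e / 2.
have c0 : 0 < c by rewrite divr_gt0.
have Phi1 : `|Phi x - Phi (x + c)| <= eta / 2.
  apply: Phie; rewrite /= opprD addNKr normrN gtr0_norm// /c; lra.
have Phi2 : `|Phi x - Phi (x - c)| <= eta / 2.
  apply: Phie; rewrite /= opprB addrC subrK gtr0_norm// /c; lra.
have mY n : measurable_fun setT (Y n) by exact: (measurable_funP (Y n)).
have mid : measurable_fun setT (id : measurableTypeR R -> R) by [].
have /cvgrPdist_le/(_ _ eta2) H1 := hY _ (@continuous_ramp R x c) (@ramp_norm_le1 R x c).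
have /cvgrPdist_le/(_ _ eta2) H2 := hY _ (@continuous_ramp R (x - c) c) (@ramp_norm_le1 R (x - c) c).
near=> n.
have h1 : `|\int[mu]_y ramp x c y - \int[P]_t ramp x c (Y n t)| <= eta / 2 by near: n.
have h2 : `|\int[mu]_y ramp (x - c) c y - \int[P]_t ramp (x - c) c (Y n t)| <= eta / 2 by near: n.
have [a1 _] := ramp_sandwich P x (mY n) c0.
have [_ b1] := ramp_sandwich mu x mid c0.
have [_] := ramp_sandwich P (x - c) (mY n) c0; rewrite subrK => a2.
have [b2 _] := ramp_sandwich mu (x - c) mid c0.
move: h1 h2 Phi1 Phi2 a1 a2 b1 b2; rewrite /= -/(G n) !preimage_id -/(Phi _) -/(Phi _).
rewrite !ler_norml; lra.
Unshelve. all: by end_near. Qed.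

(** * Stein's bound and the central limit theorem for quadratic forms *)

Section stein_quad.
Context {d : measure_display} {T : measurableType d} {R : realType}
  (P : probability T R) {V : finType} (X : V -> {RV P >-> R}).
Hypothesis hX : iid_standard_normal X.
Variable M : V -> V -> R.
Hypothesis symM : forall j k, M j k = M k j.
Hypothesis diagM : forall j, M j j = 0.

Let tr2 := \sum_i sqr_matrix M i i.
Let tr4 := \sum_i sqr_matrix (sqr_matrix M) i i.
Hypothesis tr2_gt0 : 0 < tr2.
Let sigma := Num.sqrt (2 * tr2).
Let F t := sigma^-1 * quad_form X M t.

Let sigma_gt0 : 0 < sigma.
Proof. by rewrite sqrtr_gt0 mulr_gt0. Qed.

Let sigma2E : sigma ^+ 2 = 2 * tr2.
Proof. by rewrite sqr_sqrtr// mulr_ge0// ltW. Qed.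

(** Integration by parts turns [F * f F] into [(|M X|^2 / tr (M^2)) * f' F]. What is
    left is the mean of [1 - |M X|^2 / tr (M^2)] in absolute value, which is
    estimated through [`|y| <= e + y ^+ 2 / e] and the variance of [|M X|^2]. *)
Lemma stein_quad_form_bound (f f' : R -> R) (K e : R) : 0 < e ->
  (forall x : R, is_derive x 1 f (f' x)) -> continuous f' ->
  (forall x, `|f' x| <= K) ->
  [/\ P.-integrable setT (EFin \o (fun t => F t * f (F t))),
      P.-integrable setT (EFin \o (fun t => f' (F t))) &
      `|\int[P]_t (f' (F t) - F t * f (F t))| <=
        K * (e + 2 * tr4 / tr2 ^+ 2 / e)].
Proof.
move=> e0 df cf' f'K.
have K0 : 0 <= K := le_trans (normr_ge0 _) (f'K 0).
have s0 := sigma_gt0; have sN0 : sigma != 0 by rewrite gt_eqF.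
have si0 : 0 <= sigma^-1 by rewrite invr_ge0 ltW.
have tN0 : tr2 != 0 by rewrite gt_eqF.
(* Rescaling [f] is what turns [quad_form X M t] into [F t]. *)
pose g x := f (sigma^-1 * x); pose g' x := sigma^-1 * f' (sigma^-1 * x).
have dg (x : R) : is_derive x 1 g (g' x).
  have dl : is_derive x 1 (fun x : R => sigma^-1 * x) sigma^-1.
    by apply: is_derive_eq; rewrite /GRing.scale/=; ring.
  have := @is_derive1_comp R f (fun x : R => sigma^-1 * x) x _ _ (df _) dl.
  by rewrite mulrC.
have cl : continuous (fun x : R => sigma^-1 * x).
  by move=> x; apply: cvgM; [exact: cvg_cst|exact: cvg_id].
have cg' : continuous g'.
  move=> x; have cc : {for x, continuous (f' \o (fun x : R => sigma^-1 * x))}.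
    by apply: continuous_comp; [exact: cl|exact: cf'].
  by apply: cvgM; [exact: cvg_cst|exact: cc].
have g'K x : `|g' x| <= sigma^-1 * K.
  by rewrite /g' normrM (ger0_norm si0) ler_wpM2l.
have [i1 i2 i3 E] := gaussian_ibp_quad_form hX symM dg cg' g'K.
have {}E : \int[P]_t (quad_form X M t * g (quad_form X M t)) =
    2 * \int[P]_t (lin_sqr_sum X M t * g' (quad_form X M t)).
  by rewrite E big1 ?mul0r ?add0r// => i _; exact: diagM.
pose L t := lin_sqr_sum X M t.
have mf' : measurable_fun setT f' by exact: continuous_measurable_fun.
have mF : measurable_fun setT F.
  by apply: measurable_funM => //; exact: measurable_quad_form.
have if' : P.-integrable setT (EFin \o (fun t => f' (F t))).
  apply: (@integrable_bounded _ _ _ _ _ K); last by move=> t; exact: f'K.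
  exact: (measurableT_comp mf' mF).
have iFf : P.-integrable setT (EFin \o (fun t => F t * f (F t))).
  apply: eq_integrable (integrableZl measurableT sigma^-1 i1) => // t _.
  by rewrite /= -EFinM mulrA.
have iLf : P.-integrable setT (EFin \o (fun t => L t / tr2 * f' (F t))).
  apply: eq_integrable (integrableZl measurableT (sigma / tr2) i3) => // t _.
  by rewrite /= -EFinM /g' /L /F; congr (_%:E); field; rewrite sN0 tN0.
have EF : \int[P]_t (F t * f (F t)) = \int[P]_t (L t / tr2 * f' (F t)).
  transitivity (sigma^-1 * \int[P]_t (quad_form X M t * g (quad_form X M t))).
    by rewrite -RintegralZl//; apply: eq_Rintegral => t _; rewrite mulrA.
  rewrite E -!RintegralZl//; last first.
    exact: (integrableZl measurableT 2 i3).
  apply: eq_Rintegral => t _; rewrite /g' -/(L t) -/(F t).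
  have -> : tr2 = sigma ^+ 2 / 2 by rewrite sigma2E mulrAC divff// mul1r.
  by field.
split => //.
rewrite RintegralB// EF -RintegralB//.
have [iV EV] := variance_quad_form hX (sqr_matrix_sym symM).
pose c := (tr2 ^+ 2 * e)^-1; pose v t := e + c * (L t - tr2) ^+ 2.
have iV' : P.-integrable setT (EFin \o (fun t => (L t - tr2) ^+ 2)).
  by apply: eq_integrable iV => // t _; rewrite /= /L lin_sqr_sumE.
have icV := integrableZl measurableT c iV'.
have ie := finite_measure_integrable_cst P e measurableT.
have iv : P.-integrable setT (EFin \o v).
  by apply: eq_integrable (integrableD measurableT ie icV) => // t _.
have vE : \int[P]_t v t = e + 2 * tr4 / tr2 ^+ 2 / e.
  rewrite /v RintegralD// RintegralZl// Rintegral_cst//.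
  rewrite [X in e * fine X]probability_setT mulr1 -[RHS]addr0 -[RHS]addrA addr0.
  congr (_ + _).
  have -> : \int[P]_t (L t - tr2) ^+ 2 = 2 * tr4.
    by rewrite -EV; apply: eq_Rintegral => t _; rewrite /L lin_sqr_sumE.
  by rewrite /c invfM; ring.
rewrite -vE -RintegralZl//.
have iD := integrableB measurableT if' iLf.
apply: le_trans (le_normr_Rintegral measurableT iD) _.
apply: le_Rintegral => //; first exact: (integrable_norm iD).
  exact: (integrableZl measurableT K iv).
move=> t _.
have -> : f' (F t) - L t / tr2 * f' (F t) = (1 - L t / tr2) * f' (F t) by ring.
rewrite normrM mulrC; apply: ler_pM => //.
have -> : v t = e + (1 - L t / tr2) ^+ 2 / e.
  by rewrite /v /c; field; rewrite tN0 gt_eqF.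
have := real_normK (num_real (1 - L t / tr2)); have := normr_ge0 (1 - L t / tr2).
set y := `|_| => y0 <-.
(* The inequality [y <= e + y ^+ 2 / e] by completing the square. *)
rewrite -subr_ge0.
have -> : e + y ^+ 2 / e - y = ((y - e / 2) ^+ 2 + 3 / 4 * e ^+ 2) / e.
  by field; rewrite gt_eqF.
apply: divr_ge0; last exact: ltW.
by rewrite addr_ge0 ?sqr_ge0// mulr_ge0// sqr_ge0.
Qed.
End stein_quad.

(** The derivative of the solution of Stein's equation is bounded by a constant that
    depends on the test function only, so that letting [n] tend to infinity before
    the free parameter of [stein_quad_form_bound] tends to [0] suffices. *)
Lemma quad_form_CLT (d : measure_display) (T : measurableType d) (R : realType)
    (P : probability T R) (V : nat -> finType)
    (X : forall n, V n -> {RV P >-> R}) (M : forall n, V n -> V n -> R)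
    (Y : nat -> {RV P >-> R}) (r : nat -> R) :
  (forall n, iid_standard_normal (X n)) ->
  (forall n j k, M n j k = M n k j) -> (forall n j, M n j j = 0) ->
  (\forall n \near \oo, 0 < \sum_i sqr_matrix (M n) i i) ->
  (\forall n \near \oo, (\sum_i sqr_matrix (sqr_matrix (M n)) i i) /
     (\sum_i sqr_matrix (M n) i i) ^+ 2 <= r n) ->
  r n @[n --> \oo] --> (0 : R) ->
  (forall n t, Y n t = (Num.sqrt (2 * \sum_i sqr_matrix (M n) i i))^-1 *
     quad_form (X n) (M n) t) ->
  cvg_in_distribution Y (normal_prob 0 1).
Proof.
move=> hX symM diagM tr2_gt0 ratio r0 YE.
apply: cvg_in_distribution_continuous_bounded => h ch h1.
have [f [f' [K [df cf' f'K stein]]]] := stein_equation_solution ch h1.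
have K0 : 0 <= K := le_trans (normr_ge0 _) (f'K 0).
apply/cvgrPdist_le => eta eta0.
(* As soon as [r n <= e ^+ 2 / 2], the bound of [stein_quad_form_bound] is at most
   [K * (e + e)]; this choice of [e] keeps it below [eta], even for [K = 0]. *)
pose e := eta / (2 * (K + 1)).
have e0 : 0 < e by rewrite divr_gt0// mulr_gt0// ltr_wpDl.
have e20 : 0 < e ^+ 2 / 2 by rewrite divr_gt0// exprn_gt0.
move/cvgrPdist_le : r0 => /(_ _ e20) r0.
near=> n.
have t0 : 0 < \sum_i sqr_matrix (M n) i i by near: n.
have rn : (\sum_i sqr_matrix (sqr_matrix (M n)) i i) /
  (\sum_i sqr_matrix (M n) i i) ^+ 2 <= r n by near: n.
have re : `|0 - r n| <= e ^+ 2 / 2 by near: n.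
rewrite sub0r normrN in re; have {}re := le_trans (ler_norm _) re.
have [i1 i2] := stein_quad_form_bound (hX n) (symM n) (diagM n) t0 e0 df cf' f'K.
set c := \int[normal_prob 0 1]_y h y.
have -> : \int[P]_t (f' ((Num.sqrt (2 * \sum_i sqr_matrix (M n) i i))^-1 * quad_form (X n) (M n) t) -
   (Num.sqrt (2 * \sum_i sqr_matrix (M n) i i))^-1 * quad_form (X n) (M n) t *
   f ((Num.sqrt (2 * \sum_i sqr_matrix (M n) i i))^-1 * quad_form (X n) (M n) t)) =
   \int[P]_t h (Y n t) - c.
  transitivity (\int[P]_t (h (Y n t) - c)).
    by apply: eq_Rintegral => t _; rewrite stein YE.
  rewrite RintegralB//.
  - by rewrite Rintegral_cst// [X in _ - _ * fine X]probability_setT mulr1.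
  - apply: (@integrable_bounded _ _ _ _ _ 1); last by move=> t; exact: h1.
    apply: (measurableT_comp (continuous_measurable_fun ch)).
    exact: (measurable_funP (Y n)).
  - exact: finite_measure_integrable_cst.
rewrite distrC => /le_trans; apply.
set q := \sum_i sqr_matrix (sqr_matrix _) i i in rn *.
set s := \sum_i sqr_matrix (M n) i i in rn *.
have le1 : 2 * q / s ^+ 2 / e <= e.
  rewrite ler_pdivrMr// -expr2 (_ : 2 * q / s ^+ 2 = 2 * (q / s ^+ 2)).
    move: (le_trans rn re); set y := q / _; lra.
  by rewrite mulrA.
apply: (@le_trans _ _ (K * (e + e))); first by rewrite ler_wpM2l// lerD2l.
have eE : e * (2 * (K + 1)) = eta.
  by rewrite /e divfK// gt_eqF// mulr_gt0// ltr_wpDl.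
by nra.
Unshelve. all: by end_near. Qed.

(** * Adjacency matrices *)

Section graph.
Context {R : realType} {V : finType} (E : {set V * V}).
Hypothesis symE : forall v w, ((v, w) \in E) = ((w, v) \in E).

Definition adjacency (v w : V) : R := ((v, w) \in E)%:R.

Lemma adjacency_sym v w : adjacency v w = adjacency w v.
Proof. by rewrite /adjacency symE. Qed.

Lemma sum_adjacency : \sum_v \sum_w adjacency v w = #|E|%:R.
Proof.
rewrite pair_big/= -natr_sum -sum1_card [in RHS]big_mkcond/=; congr (_%:R).
by apply: eq_bigr => -[v w] _ /=; case: (_ \in _).
Qed.

Lemma trace_sqr_adjacency : \sum_v sqr_matrix adjacency v v = #|E|%:R.
Proof.
rewrite -sum_adjacency; apply: eq_bigr => v _; apply: eq_bigr => w _.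
by rewrite /adjacency (symE w v) -natrM mulnb andbb.
Qed.

(** The trace counts the closed walks [v, l, k, m, v]. Forgetting that the last step
    closes the walk leaves an edge followed by two free steps. *)
Lemma trace_pow4_adjacency (D : R) :
  (forall v, \sum_w adjacency v w <= D) ->
  \sum_v sqr_matrix (sqr_matrix adjacency) v v <= #|E|%:R * D ^+ 2.
Proof.
move=> degE.
have adj0 v w : 0 <= adjacency v w by exact: ler0n.
have adj1 v w : adjacency v w <= 1 by rewrite /adjacency; case: (_ \in _).
rewrite -sum_adjacency mulr_suml; apply: ler_sum => v _.
have D0 : 0 <= D by apply: le_trans (degE v); exact: sumr_ge0.
pose S := \sum_k (\sum_l adjacency v l * adjacency l k * \sum_m adjacency k m).
apply: (@le_trans _ _ S).
  apply: ler_sum => k _; rewrite {1}/sqr_matrix -mulr_suml.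
  apply: ler_wpM2l; first by apply: sumr_ge0 => l _; exact: mulr_ge0.
  by apply: ler_sum => m _; rewrite -[leRHS]mulr1 ler_wpM2l.
rewrite /S exchange_big/= mulr_suml; apply: ler_sum => l _.
rewrite expr2 (eq_bigr (fun k => adjacency v l * (adjacency l k * \sum_m adjacency k m))); last first.
  by move=> k _; rewrite mulrA.
rewrite -mulr_sumr; apply: ler_wpM2l => //.
apply: (@le_trans _ _ (\sum_k adjacency l k * D)).
  by apply: ler_sum => k _; exact: ler_wpM2l.
by rewrite -mulr_suml ler_wpM2r.
Qed.
End graph.

Lemma edge_formE (d : measure_display) (T : measurableType d) (R : realType)
    (P : probability T R) (V : finType) (E : {set V * V})
    (X : V -> {RV P >-> R}) t :
  edge_form E X t = quad_form X (adjacency E) t.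
Proof.
have ev (s : seq V) (G : V -> {mfun T >-> R}) :
    (\sum_(v <- s) G v) t = \sum_(v <- s) G v t.
  by elim: s => [|v s IH]; rewrite ?big_nil// !big_cons -IH.
rewrite /edge_form /quad_form ev; apply: eq_bigr => v _.
rewrite ev /lin_form mulr_sumr; apply: eq_bigr => w _ /=.
transitivity ((((v, w) \in E)%:R : {mfun T >-> R}) t * X v t * X w t) => //.
have -> : (((v, w) \in E)%:R : {mfun T >-> R}) t = ((v, w) \in E)%:R.
  by case: (_ \in _).
by rewrite /adjacency; ring.
Qed.

Local Close Scope ring_scope.
Local Close Scope classical_set_scope.

(** * Counting edges of the grid inside blocks *)

Section grid_count.
Variables (n : nat) (Sv Sh : 'I_n -> {set grid n}).
Hypothesis hSv : forall a, Sv a \subset [set v : grid n | v.1 == a].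
Hypothesis hSh : forall b, Sh b \subset [set v : grid n | v.2 == b].
Implicit Types (v w : grid n) (B : {set grid n}).

Local Notation E := (grid_edges Sv Sh).

Lemma SvP a v : v \in Sv a -> v.1 = a.
Proof. by move/(fintype.subsetP (hSv a)); rewrite inE => /eqP. Qed.

Lemma ShP b v : v \in Sh b -> v.2 = b.
Proof. by move/(fintype.subsetP (hSh b)); rewrite inE => /eqP. Qed.

Lemma sum_in_Sh v w : \sum_b ((v \in Sh b) && (w \in Sh b)) =
  (v \in Sh v.2) && (w \in Sh v.2).
Proof.
rewrite (bigD1 v.2)//= big1 ?addn0// => b bv.
by case: (boolP (v \in Sh b)) => // /ShP vb; rewrite vb eqxx in bv.
Qed.

Lemma sum_in_Sv v w : \sum_a ((v \in Sv a) && (w \in Sv a)) =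
  (v \in Sv v.1) && (w \in Sv v.1).
Proof.
rewrite (bigD1 v.1)//= big1 ?addn0// => b bv.
by case: (boolP (v \in Sv b)) => // /SvP vb; rewrite vb eqxx in bv.
Qed.

(** The lines that can contain [v] are its own row and its own column. *)
Lemma mem_grid_edges v w : ((v, w) \in E) = (v != w) &&
  ((v \in Sh v.2) && (w \in Sh v.2) || (v \in Sv v.1) && (w \in Sv v.1)).
Proof.
rewrite inE /=; congr (_ && (_ || _)).
- apply/existsP/idP => [[b /andP[vb wb]]|?]; last by exists v.2.
  by rewrite (ShP vb) vb.
- apply/existsP/idP => [[b /andP[vb wb]]|?]; last by exists v.1.
  by rewrite (SvP vb) vb.
Qed.

(** Two distinct points never share both a row and a column, so that the two kinds
    of edges do not overlap; the diagonal term compensates for [v == w]. *)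
Lemma grid_edges_pointwise v w :
  ((v, w) \in E) + (v == w) * (\sum_b (v \in Sh b) + \sum_a (v \in Sv a)) =
  \sum_b ((v \in Sh b) && (w \in Sh b)) + \sum_a ((v \in Sv a) && (w \in Sv a)).
Proof.
rewrite mem_grid_edges !sum_in_Sh !sum_in_Sv.
have -> : \sum_b (v \in Sh b) = (v \in Sh v.2).
  by rewrite -[v \in Sh v.2]andbb -sum_in_Sh; apply: eq_bigr => b _; rewrite andbb.
have -> : \sum_a (v \in Sv a) = (v \in Sv v.1).
  by rewrite -[v \in Sv v.1]andbb -sum_in_Sv; apply: eq_bigr => a _; rewrite andbb.
have [<-|vw] /= := eqVneq v w; first by rewrite !andbb add0n mul1n.
rewrite mul0n addn0.
case: andP => [[vh wh]|_] //=; case: andP => [[vc wc]|_] //=.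
case/eqP: vw; rewrite (surjective_pairing v) (surjective_pairing w).
by rewrite (ShP wh) (SvP wc).
Qed.

Lemma grid_edges_sym v w : ((v, w) \in E) = ((w, v) \in E).
Proof.
rewrite !inE /= eq_sym; congr (_ && (_ || _)).
  by apply: eq_existsb => b; rewrite andbC.
by apply: eq_existsb => a; rewrite andbC.
Qed.

Lemma grid_degree_le v : \sum_w ((v, w) \in E) <= 2 * n.
Proof.
apply: (@leq_trans (\sum_(w : grid n) ((w.2 == v.2) + (w.1 == v.1)))).
  apply: leq_sum => w _; rewrite mem_grid_edges; case: (v != w) => //=.
  case: (boolP (w \in Sh v.2)) => [/ShP->|_].
    by rewrite eqxx; apply: leq_trans (leq_b1 _) (leq_addr _ _).
  case: (boolP (w \in Sv v.1)) => [/SvP->|_]; last by rewrite !andbF.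
  by rewrite eqxx; apply: leq_trans (leq_b1 _) (leq_addl _ _).
rewrite big_split/= mul2n -addnn.
rewrite -(pair_bigA _ (fun a b : 'I_n => nat_of_bool (b == v.2)))/=.
rewrite -(pair_bigA _ (fun a b : 'I_n => nat_of_bool (a == v.1)))/=.
rewrite [X in _ + X]exchange_big/=.
apply: leq_add; rewrite -[leqRHS]muln1 -[n in leqRHS]card_ord -sum_nat_const.
  by apply: leq_sum => a _; rewrite (bigD1 v.2)//= eqxx big1// => b /negPf ->.
by apply: leq_sum => a _; rewrite (bigD1 v.1)//= eqxx big1// => b /negPf ->.
Qed.

Definition edges_in B : nat := #|E :&: finset.setX B B|.

Lemma card_setIE (A B : {set grid n}) : #|B :&: A| = \sum_(v in B) (v \in A).
Proof.
rewrite -sum1_card big_mkcond [RHS]big_mkcond; apply: eq_bigr => v _.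
by rewrite inE; case: (v \in B).
Qed.

Lemma sqr_card_setIE (A B : {set grid n}) :
  #|B :&: A| ^ 2 = \sum_(v in B) \sum_(w in B) ((v \in A) && (w \in A)).
Proof.
rewrite card_setIE -mulnn big_distrl/=; apply: eq_bigr => v _.
by rewrite big_distrr/=; apply: eq_bigr => w _; rewrite mulnb.
Qed.

Lemma edges_inE B : edges_in B = \sum_(v in B) \sum_(w in B) ((v, w) \in E).
Proof.
rewrite /edges_in -sum1_card (pair_big_dep (mem B) (fun=> mem B)) /=.
rewrite big_mkcond [RHS]big_mkcond; apply: eq_bigr => -[v w] _ /=.
by rewrite finset.in_setI finset.in_setX/=; case: (v \in B); case: (w \in B); rewrite ?andbT ?andbF.
Qed.

(** Obtained by summing [grid_edges_pointwise] over pairs; the additive form avoids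
    truncated subtraction in the number [N ^ 2 - N] of ordered pairs of distinct
    points of a trace of size [N]. *)
Lemma edges_in_count B :
  edges_in B + (\sum_b #|B :&: Sh b| + \sum_a #|B :&: Sv a|) =
  \sum_b #|B :&: Sh b| ^ 2 + \sum_a #|B :&: Sv a| ^ 2.
Proof.
have sumE (S : 'I_n -> {set grid n}) :
    \sum_b #|B :&: S b| = \sum_(v in B) \sum_(w in B) (v == w) * \sum_b (v \in S b).
  under eq_bigr do rewrite card_setIE.
  rewrite exchange_big/=; apply: eq_bigr => v vB.
  rewrite [RHS](bigD1 v)//= eqxx mul1n [X in _ + X]big1 ?addn0// => w /andP[_ wv].
  by rewrite eq_sym (negPf wv).
have sqrE (S : 'I_n -> {set grid n}) :
    \sum_b #|B :&: S b| ^ 2 =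
    \sum_(v in B) \sum_(w in B) \sum_b ((v \in S b) && (w \in S b)).
  under eq_bigr do rewrite sqr_card_setIE.
  by rewrite exchange_big/=; apply: eq_bigr => v vB; rewrite exchange_big.
rewrite edges_inE !sumE !sqrE -!big_split/=; apply: eq_bigr => v _.
rewrite -!big_split/=; apply: eq_bigr => w _.
by rewrite -mulnDr grid_edges_pointwise.
Qed.

Section blocks.
Variables (k m : nat) (B : 'I_m -> {set grid n}).
Hypothesis cSv : forall a, #|Sv a| = k.
Hypothesis cSh : forall b, #|Sh b| = k.

Lemma card_grid_edges : #|E| + 2 * n * k = 2 * n * k ^ 2.
Proof.
have := edges_in_count [set: grid n].
rewrite /edges_in (_ : finset.setX _ _ = [set: _]) ?finset.setIT; last first.
  by apply/finset.setP => -[v w]; rewrite !inE.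
under eq_bigr do rewrite finset.setTI cSh; under [X in _ + (_ + X)]eq_bigr do rewrite finset.setTI cSv.
under [X in _ = X + _]eq_bigr do rewrite finset.setTI cSh.
under [X in _ = _ + X]eq_bigr do rewrite finset.setTI cSv.
by rewrite !sum_nat_const card_ord; lia.
Qed.

Hypothesis disjB : forall i j, i != j -> [disjoint B i & B j].
Hypothesis m_gt0 : 0 < m.

Lemma sum_trace_le (A : {set grid n}) : \sum_i #|B i :&: A| <= #|A|.
Proof.
under eq_bigr do rewrite finset.setIC card_setIE.
rewrite exchange_big/= -sum1_card; apply: leq_sum => v vA.
have [i vi|no] := pickP (fun i => v \in B i); last first.
  by rewrite big1// => i _; rewrite no.
rewrite (bigD1 i)//= vi big1// => j ji.
by rewrite (disjointFr (disjB _) vi)// eq_sym.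
Qed.

Definition main_block (A : {set grid n}) : 'I_m :=
  [arg max_(i > Ordinal m_gt0) #|B i :&: A|].

Lemma main_blockP A i : #|B i :&: A| <= #|B (main_block A) :&: A|.
Proof. by rewrite /main_block; case: arg_maxnP => // j _; apply. Qed.

Definition main_trace (A : {set grid n}) := B (main_block A) :&: A.

(** Bounding one factor of each square by the largest trace leaves the sum of the
    traces of disjoint blocks. *)
Lemma sum_sqr_trace_le (A : {set grid n}) :
  \sum_i #|B i :&: A| ^ 2 <= #|A| * #|main_trace A|.
Proof.
apply: (@leq_trans (\sum_i #|B i :&: A| * #|main_trace A|)).
  by apply: leq_sum => i _; rewrite -mulnn leq_mul2l main_blockP orbT.
by rewrite -big_distrl leq_mul2r sum_trace_le orbT.
Qed.

(** The difference with its largest possible value [2 * n * k] measures how much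
    the blocks cut the lines. *)
Definition main_mass : nat :=
  \sum_b #|main_trace (Sh b)| + \sum_a #|main_trace (Sv a)|.

(** On each line, a block contains at most as many edges as the square of the size of
    its trace. *)
Lemma sum_edges_in_le : \sum_i edges_in (B i) <= k * main_mass.
Proof.
apply: (@leq_trans (\sum_i (\sum_b #|B i :&: Sh b| ^ 2 + \sum_a #|B i :&: Sv a| ^ 2))).
  by apply: leq_sum => i _; rewrite -edges_in_count leq_addr.
rewrite big_split/= /main_mass mulnDr !big_distrr/=.
apply: leq_add; rewrite exchange_big/=; apply: leq_sum => b _.
  by rewrite -(cSh b) sum_sqr_trace_le.
by rewrite -(cSv b) sum_sqr_trace_le.
Qed.

Lemma sum_main_traceE (S : 'I_n -> {set grid n}) (c : grid n -> 'I_n) :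
  (forall b v, v \in S b -> c v = b) ->
  \sum_b #|main_trace (S b)| = #|[set v | v \in main_trace (S (c v))]|.
Proof.
move=> cS; rewrite -sum1_card [RHS]big_mkcond/=.
under eq_bigr do rewrite -sum1_card big_mkcond/=.
rewrite exchange_big/=; apply: eq_bigr => v _.
rewrite inE (bigD1 (c v))//= big1 ?addn0// => b bv.
case: ifP => // /finset.setIP[_ vb].
by rewrite -(cS _ _ vb) eqxx in bv.
Qed.

Definition row_count i := #|[set b | main_block (Sh b) == i]|.

(** A point in the main trace of both its row and its column forces the two main
    blocks to coincide, blocks being disjoint. Inclusion-exclusion bounds the number
    of such points from below, and summing over columns the rows that have the same
    main block bounds it from above. *)
Lemma main_mass_le : exists i, main_mass <= n ^ 2 + n * row_count i.
Proof.
pose i0 := [arg max_(i > Ordinal m_gt0) row_count i].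
have i0P i : row_count i <= row_count i0.
  by rewrite /i0; case: arg_maxnP => // j _; apply.
exists i0; rewrite /main_mass (sum_main_traceE (c := snd)); last exact: ShP.
rewrite (sum_main_traceE (c := fst)); last exact: SvP.
set H := [set v | _]; set W := [set v | _].
rewrite -cardsUI; apply: leq_add.
  apply: leq_trans (max_card _) _.
  by rewrite card_prod !card_ord mulnn.
apply: (@leq_trans (\sum_(v : grid n) (main_block (Sh v.2) == main_block (Sv v.1)))).
  rewrite -sum1_card big_mkcond; apply: leq_sum => v _.
  rewrite finset.in_setI [v \in H]finset.in_set [v \in W]finset.in_set 2!finset.in_setI; case: ifP => // /andP[/andP[vh _] /andP[vv _]].
  case: eqVneq => // ne.
  by rewrite (disjointFr (disjB ne) vh) in vv.
rewrite -(pair_bigA _ (fun a b => nat_of_bool (main_block (Sh b) == main_block (Sv a))))/=.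
rewrite -[n in n * _]card_ord -sum_nat_const; apply: leq_sum => a _.
apply: leq_trans (i0P (main_block (Sv a))).
rewrite /row_count -sum1_card [leqRHS]big_mkcond; apply: leq_sum => b _.
by rewrite inE; case: (_ == _).
Qed.

Lemma sum_le_const (I : finType) (F : I -> nat) (p : pred I) c :
  (forall j, F j <= c) -> \sum_(j | p j) F j <= #|p| * c.
Proof. by move=> Fc; rewrite -sum_nat_const; apply: leq_sum => j _. Qed.

(** On the rows whose main block is [i], the trace [N] satisfies
    [N ^ 2 >= 2 * k * N - k ^ 2], and the total loss [k - N] over all lines is
    [2 * n * k - main_mass]. *)
Lemma edges_in_main_ge i : 2 * k * main_mass + row_count i * k ^ 2 <=
  edges_in (B i) + 2 * n * k + 4 * n * k ^ 2.
Proof.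
pose p b := main_block (Sh b) == i.
have rE : #|p| = row_count i by rewrite /row_count cardsE.
have Nk (S : {set grid n}) j : #|B j :&: S| <= #|S| by rewrite subset_leq_card// finset.subsetIr.
have h1 : \sum_(b | p b) #|main_trace (Sh b)| ^ 2 <= edges_in (B i) + 2 * n * k.
  have sh : \sum_b #|B i :&: Sh b| <= n * k.
    rewrite -[n in n * _]card_ord; apply: sum_le_const => b.
    by rewrite -(cSh b); exact: Nk.
  have sv : \sum_a #|B i :&: Sv a| <= n * k.
    rewrite -[n in n * _]card_ord; apply: sum_le_const => b.
    by rewrite -(cSv b); exact: Nk.
  have sub : \sum_(b | p b) #|main_trace (Sh b)| ^ 2 <= \sum_b #|B i :&: Sh b| ^ 2.
    rewrite big_mkcond; apply: leq_sum => b _; case: ifP => // /eqP pb.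
    by rewrite /main_trace pb.
  by have := edges_in_count (B i); lia.
have h2 : 2 * k * (\sum_(b | p b) #|main_trace (Sh b)|) <=
    \sum_(b | p b) #|main_trace (Sh b)| ^ 2 + row_count i * k ^ 2.
  rewrite -rE -sum_nat_const -big_split big_distrr/=; apply: leq_sum => b _.
  by rewrite addnC -mulnA; exact: nat_Cauchy.
(* The other rows and all the columns retain at most [k] points each. *)
have h3 : main_mass + row_count i * k <= \sum_(b | p b) #|main_trace (Sh b)| + 2 * n * k.
  have sv : \sum_a #|main_trace (Sv a)| <= n * k.
    rewrite -[n in n * _]card_ord; apply: sum_le_const => b.
    by rewrite -(cSv b); exact: Nk.
  have sh : \sum_(b | ~~ p b) #|main_trace (Sh b)| <= #|[predC p]| * k.
    by apply: sum_le_const => b; rewrite -(cSh b); exact: Nk.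
  have := cardC p; rewrite card_ord rE => pn.
  rewrite /main_mass (bigID p)/=.
  have : row_count i * k + #|[predC p]| * k = n * k by rewrite -mulnDl pn.
  move: sv sh; move: (\sum_(b | p b) _) (\sum_(b | ~~ p b) _) (\sum_a _).
  move: (row_count i * k) (#|[predC p]| * k) => u v x y z; rewrite -mulnA.
  move: (n * k) => w; lia.
have : 2 * k * (main_mass + row_count i * k) <=
  2 * k * (\sum_(b | p b) #|main_trace (Sh b)| + 2 * n * k) by rewrite leq_mul2l h3 orbT.
lia.
Qed.

(** Eliminating [main_mass] and [row_count] between [sum_edges_in_le],
    [main_mass_le] and [edges_in_main_ge]. The leading terms for the total number
    [2 * n * k ^ 2] of edges give [n * M] at least [n * k ^ 2 * (2 * k - n)],
    which is of the order of [n ^ 4] when [k / n] stays above one half. *)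
Lemma blocks_edges_bound M : (forall i, edges_in (B i) <= M) ->
  (\sum_i edges_in (B i)) * (k + 2 * n) <=
  n * M + 5 * n ^ 2 * k ^ 2 + 2 * n ^ 2 * k.
Proof.
move=> BM; have [i Gi] := main_mass_le; have := edges_in_main_ge i.
have := BM i; have := sum_edges_in_le.
set S := \sum_i _; set G := main_mass in Gi *; set e := edges_in _.
set r := row_count i in Gi *.
move=> SG eM ge.
have h1 : S * (k + 2 * n) <= k * G * (k + 2 * n) by rewrite leq_mul2r SG orbT.
have h2 : n * (2 * k * G + r * k ^ 2) <= n * (M + 2 * n * k + 4 * n * k ^ 2).
  by rewrite leq_mul2l; apply/orP; right; lia.
have h3 : G * k ^ 2 <= (n ^ 2 + n * r) * k ^ 2 by rewrite leq_mul2r Gi orbT.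
lia.
Qed.
End blocks.
End grid_count.

Local Open Scope ring_scope.

(** * Irreducibility *)

Section grid_asymptotics.
Context {R : realType} (beta : R).
Hypothesis hbeta : 1 / 2 < beta <= 1.
Variables (Sv Sh : forall n : nat, 'I_n -> {set grid n}).
Hypothesis hSv : forall (n : nat) (a : 'I_n),
  Sv a \subset [set v : grid n | v.1 == a].
Hypothesis hSh : forall (n : nat) (b : 'I_n),
  Sh b \subset [set v : grid n | v.2 == b].
Hypothesis cSv : forall (n : nat) (a : 'I_n),
  #|Sv a|%:Z = Num.floor (beta * n%:R).
Hypothesis cSh : forall (n : nat) (b : 'I_n),
  #|Sh b|%:Z = Num.floor (beta * n%:R).

Local Open Scope classical_set_scope.
Local Open Scope ring_scope.

Local Notation E n := (grid_edges (@Sv n) (@Sh n)).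

Definition line_size (n : nat) : nat := absz (Num.floor (beta * n%:R)).

Lemma card_Sv n (a : 'I_n) : #|Sv a| = line_size n.
Proof. by rewrite /line_size -(cSv a). Qed.

Lemma card_Sh n (b : 'I_n) : #|Sh b| = line_size n.
Proof. by rewrite /line_size -(cSh b). Qed.

Lemma line_size_bounds n :
  beta * n%:R - 1 <= (line_size n)%:R <= (n%:R : R).
Proof.
have /andP[b1 b2] := hbeta.
have bn : 0 <= beta * n%:R by rewrite mulr_ge0//; lra.
have kE : (line_size n)%:R = (Num.floor (beta * n%:R))%:~R :> R.
  by rewrite /line_size natr_absz ger0_norm// floor_ge0.
rewrite kE; apply/andP; split.
  by rewrite lerBlDr; have := floorD1_gt (beta * n%:R); rewrite intrD => /ltW.
by apply: le_trans (floor_le_tmp _) _; rewrite ler_piMl.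
Qed.

Lemma card_E n : #|E n|%:R + 2 * n%:R * (line_size n)%:R =
  2 * n%:R * (line_size n)%:R ^+ 2 :> R.
Proof.
have := card_grid_edges (@hSv n) (@hSh n) (@card_Sv n) (@card_Sh n).
by move/(congr1 (fun x : nat => x%:R : R)); rewrite natrD !natrM expr2.
Qed.

Lemma line_size_ge_half n : 4 / (2 * beta - 1) <= n%:R ->
  n%:R <= 2 * (line_size n)%:R :> R.
Proof.
have /andP[b1 _] := hbeta; have b0 : 0 < 2 * beta - 1 by lra.
have /andP[k1 _] := line_size_bounds n.
by rewrite ler_pdivrMr//; set N := n%:R in k1 *; nra.
Qed.

(** The numerical form of the contradiction with [blocks_edges_bound]: as [e] is close
    to [2 * N * k ^+ 2], dividing by [N * k ^+ 2] leaves
    [2 * k - N <= (2 * b - 1) / 2 * N + 14], whereas the left-hand side is at least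
    [(2 * b - 1) * N - 2]; hence the threshold [33 / (2 * b - 1)]. *)
Lemma blocks_contradiction (b N k e S M : R) : 1 / 2 < b ->
  33 / (2 * b - 1) <= N -> b * N - 1 <= k <= N -> N <= 2 * k ->
  e + 2 * N * k = 2 * N * k ^+ 2 -> 0 <= e ->
  (1 - (2 * b - 1) / 16) * e <= S -> M <= (2 * b - 1) / 16 * e ->
  S * (k + 2 * N) <= N * M + 5 * N ^+ 2 * k ^+ 2 + 2 * N ^+ 2 * k -> False.
Proof.
move=> b1 N0 /andP[k1 k2] Nk eE e0 Se Me SM.
have p0 : 0 < 2 * b - 1 by lra.
pose eps := (2 * b - 1) / 16; rewrite -/eps in Se Me.
have eps0 : 0 < eps by rewrite /eps; lra.
move: N0; rewrite ler_pdivrMr// => N0.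
have N1 : 0 < N by nra.
have k0 : 0 < k by lra.
have h1 : (1 - eps) * e * (k + 2 * N) <= S * (k + 2 * N) by apply: ler_wpM2r => //; lra.
have h2 : N * M <= N * (eps * e) by apply: ler_wpM2l => //; lra.
have h3 : eps * e * (k + 3 * N) <= eps * e * (4 * N).
  by apply: ler_wpM2l; [rewrite mulr_ge0// ltW|lra].
have h4 : e * (k + 2 * N) <= eps * e * (4 * N) + 5 * N ^+ 2 * k ^+ 2 + 2 * N ^+ 2 * k.
  by lra.
have Nk0 : 0 <= N * k by rewrite mulr_ge0// ltW.
have h5 : eps * e * (4 * N) <= eps * (2 * N * k ^+ 2) * (4 * N).
  apply: ler_wpM2r; first by lra.
  by apply: ler_wpM2l; lra.
have h6 : (N * k) * (2 * k ^+ 2 - N * k - 2 * k - 6 * N) <= (N * k) * (8 * eps * N * k).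
  have eE' : e = 2 * N * k ^+ 2 - 2 * N * k by lra.
  rewrite eE' in h4 h5; lra.
have NkP : 0 < N * k by rewrite mulr_gt0.
rewrite ler_pM2l// in h6.
have h7 : k * (2 * k - N - 14) <= k * (8 * eps * N) by lra.
rewrite ler_pM2l// in h7.
by rewrite /eps in h7; lra.
Qed.

Lemma grid_irreducible : irreducible R (fun n => E n).
Proof.
case=> m [B [disjB mB sumB maxB]].
have /andP[b1 b2] := hbeta.
pose eps := (2 * beta - 1) / 16.
have eps0 : 0 < eps by rewrite /eps; lra.
have m_gt0 : \forall n \near \oo, (0 < m n)%N by exact: (mB _ (nbhs_infty_gt 0)).
move/cvgrPdist_le : sumB => /(_ _ eps0) sumB.
move/cvgrPdist_le : maxB => /(_ _ eps0) maxB.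
near \oo => n.
have m0 : (0 < m n)%N by near: n.
have N1 : 33 / (2 * beta - 1) <= (n%:R : R) by near: n; exact: nbhs_infty_ger.
have N2 : 4 / (2 * beta - 1) <= (n%:R : R) by near: n; exact: nbhs_infty_ger.
have s1 : `|1 - (2 * #|E n|)%N%:R^-1 *
  (\sum_(i < m n) sigma2 (E n) (B n i))%N%:R| <= eps by near: n.
have s2 : `|0 - (2 * #|E n|)%N%:R^-1 *
  (\max_(i < m n) sigma2 (E n) (B n i))%N%:R| <= eps by near: n.
set mx := (\max_(i < m n) _)%N in s2.
(* Half of [mx], because [sigma2] counts every ordered pair twice. *)
have bound := blocks_edges_bound (@hSv n) (@hSh n) (@card_Sv n) (@card_Sh n)
  (@disjB n) m0 (M := mx./2).
have : forall i, (edges_in (@Sv n) (@Sh n) (B n i) <= mx./2)%N.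
  move=> i; rewrite geq_half_double -mul2n.
  exact: (@leq_bigmax _ (fun i => sigma2 (E n) (B n i)) i).
move/bound => {}bound.
have SE : (\sum_(i < m n) sigma2 (E n) (B n i) =
    2 * \sum_i edges_in (@Sv n) (@Sh n) (B n i))%N by rewrite big_distrr.
rewrite SE in s1; set S := (\sum_i _)%N in bound s1.
have p0 : 0 < 2 * beta - 1 by lra.
have half := line_size_ge_half N2.
have e0 : 0 < (#|E n|%:R : R).
  have := card_E n; move: N1; rewrite ler_pdivrMr//.
  move: half; set N := n%:R; set k := (line_size n)%:R => half N1 eE.
  have N33 : 33 <= N by nra.
  have : 0 < N * k * (k - 1) by rewrite !mulr_gt0//; lra.
  lra.
apply: (@blocks_contradiction beta n%:R (line_size n)%:R #|E n|%:R S%:R (mx./2)%:R) => //.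
- exact: line_size_bounds.
- exact: card_E.
- move: s1; rewrite !natrM invfM mulrACA mulVf ?pnatr_eq0// mul1r.
  rewrite ler_norml => /andP[_ h]; rewrite -/eps -ler_pdivlMr// [S%:R / _]mulrC.
  lra.
- move: s2; rewrite sub0r normrN ger0_norm ?mulr_ge0 ?invr_ge0//.
  rewrite mulrC ler_pdivrMr ?natrM ?mulr_gt0// -/eps => h.
  have : (2 * mx./2)%N%:R <= (mx%:R : R) by rewrite ler_nat mul2n -{2}(odd_double_half mx) leq_addl.
  by rewrite natrM; lra.
- by move: bound; rewrite -(ler_nat R) !(natrD, natrM) -!expr2.
Unshelve. all: by end_near. Qed.
End grid_asymptotics.

(** * The central limit theorem on the grid *)

Section reindex.
Local Open Scope classical_set_scope.
Local Open Scope ring_scope.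

(** The sets prescribed on [I] are transported along [g] and completed by the full set
    outside its image. *)
Lemma iid_standard_normal_reindex (d : measure_display) (T : measurableType d)
    (R : realType) (P : probability T R) (I : finType) (J : eqType)
    (X : J -> {RV P >-> R}) (g : I -> J) : injective g ->
  iid_standard_normal X -> iid_standard_normal (fun i => X (g i)).
Proof.
move=> g_inj [indX lawX]; split; last by move=> i; exact: lawX.
move=> s A us mA.
pose A' j := if [pick i | g i == j] is Some i then A i else setT.
have A'E i : A' (g i) = A i.
  rewrite /A'; case: pickP => [i' /eqP /g_inj ->//|/(_ i)].
  by rewrite eqxx.
have mA' j : measurable (A' j) by rewrite /A'; case: pickP.
have := indX (map g s) A' _ mA'; rewrite map_inj_uniq// => /(_ us).
rewrite big_map; under eq_bigr do rewrite A'E; move=> <-; congr (P _).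
apply/seteqP; split => [t At j /mapP[i si ->]|t At i si].
  by rewrite A'E; exact: At.
by rewrite -A'E; apply: At; exact: map_f.
Qed.
End reindex.

Section grid_CLT.
Context {d : measure_display} {T : measurableType d} {R : realType}
  (P : probability T R) (X : nat * nat -> {RV P >-> R}) (beta : R).
Hypothesis hX : iid_standard_normal X.
Hypothesis hbeta : 1 / 2 < beta <= 1.
Variables (Sv Sh : forall n : nat, 'I_n -> {set grid n}).
Hypothesis hSv : forall (n : nat) (a : 'I_n),
  Sv a \subset [set v : grid n | v.1 == a].
Hypothesis hSh : forall (n : nat) (b : 'I_n),
  Sh b \subset [set v : grid n | v.2 == b].
Hypothesis cSv : forall (n : nat) (a : 'I_n),
  #|Sv a|%:Z = Num.floor (beta * n%:R).
Hypothesis cSh : forall (n : nat) (b : 'I_n),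
  #|Sh b|%:Z = Num.floor (beta * n%:R).

Local Open Scope classical_set_scope.
Local Open Scope ring_scope.

Local Notation E n := (grid_edges (@Sv n) (@Sh n)).
Local Notation Z n := (edge_form (E n) (fun v : grid n => X (v.1 : nat, v.2 : nat))).

Lemma card_E_ge (n : nat) : 4 / (2 * beta - 1) <= n%:R ->
  n%:R ^+ 3 / 4 <= #|E n|%:R :> R.
Proof.
move=> n0; have half := line_size_ge_half hbeta n0.
have /andP[b1 b2] := hbeta.
have p0 : 0 < 2 * beta - 1 by lra.
have := card_E hSv hSh cSv cSh n; move: n0; rewrite ler_pdivrMr//.
move: half; set N := n%:R; set k := (line_size beta n)%:R => half n0 eE.
have N4 : 4 <= N by nra.
have h : N * (N * N) <= N * ((2 * k) * (4 * (k - 1))).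
  by apply: ler_wpM2l; [lra|apply: ler_pM; lra].
lra.
Qed.

Lemma grid_CLT : cvg_in_distribution
  (fun n => (Num.sqrt (2 * #|E n|)%N%:R)^-1 \o* Z n : {RV P >-> R})
  (normal_prob 0 1).
Proof.
have /andP[b1 b2] := hbeta.
have p0 : 0 < 2 * beta - 1 by lra.
have symE n := @grid_edges_sym n (@Sv n) (@Sh n).
apply: (@quad_form_CLT d T R P grid (fun n v => X (v.1 : nat, v.2 : nat))
  (fun n => adjacency (E n)) _ (fun n => 32 * harmonic n)).
- move=> n; apply: (@iid_standard_normal_reindex _ _ _ _ _ _ X
    (fun v : grid n => (v.1 : nat, v.2 : nat))) => //.
  by move=> [a b] [a' b'] [/val_inj -> /val_inj ->].
- by move=> n; exact: adjacency_sym (symE n).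
- by move=> n v; rewrite /adjacency inE /= eqxx.
- near=> n; rewrite (trace_sqr_adjacency (symE n)).
  have n0 : 4 / (2 * beta - 1) <= n%:R :> R by near: n; exact: nbhs_infty_ger.
  have n1 : 1 <= n%:R :> R by near: n; exact: nbhs_infty_ger.
  apply: lt_le_trans (card_E_ge n0).
  by rewrite divr_gt0// exprn_gt0//; lra.
- near=> n; rewrite (trace_sqr_adjacency (symE n)).
  have n0 : 4 / (2 * beta - 1) <= n%:R :> R by near: n; exact: nbhs_infty_ger.
  have n1 : 1 <= n%:R :> R by near: n; exact: nbhs_infty_ger.
  have ge := card_E_ge n0.
  have deg (v : grid n) : \sum_w adjacency (R := R) (E n) v w <= 2 * n%:R.
    by rewrite -natr_sum -natrM ler_nat; exact: grid_degree_le.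
  have tr4 := trace_pow4_adjacency deg.
  rewrite /harmonic/=.
  have e0 : 0 < #|E n|%:R :> R.
    by apply: lt_le_trans ge; rewrite divr_gt0// exprn_gt0//; lra.
  (* With [n ^+ 3 / 4 <= #|E n|], the ratio [(2 * n) ^+ 2 / #|E n|] is at most
     [16 / n], hence at most [32 / n.+1]. *)
  rewrite ler_pdivrMr ?exprn_gt0//.
  apply: le_trans tr4 _.
  have np : 0 < n.+1%:R :> R by rewrite ltr0n.
  rewrite expr2 [leRHS]mulrCA; apply: ler_wpM2l; first exact: ltW.
  rewrite [leRHS]mulrAC ler_pdivlMr// -(natr1 n).
  have := ler_wpM2l (sqr_ge0 (n%:R : R)) n1.
  move: ge; set N := n%:R; set e := #|_|%:R; lra.
- rewrite -[X in _ --> X](mulr0 32); apply: cvgMr; exact: cvg_harmonic.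
- move=> n t; rewrite (trace_sqr_adjacency (symE n)) /= edge_formE natrM mulrC.
  by [].
Unshelve. all: by end_near. Qed.
End grid_CLT.

Theorem theorem2p13 (d : measure_display) (T : measurableType d)
  (R : realType) (P : probability T R)
  (X : nat * nat -> {RV P >-> R}) (hX : iid_standard_normal X)
  (beta : R) (hbeta : 1 / 2 < beta <= 1)
  (Sv Sh : forall n : nat, 'I_n -> {set grid n})
  (hSv : forall (n : nat) (a : 'I_n),
     Sv n a \subset [set v : grid n | v.1 == a])
  (hSh : forall (n : nat) (b : 'I_n),
     Sh n b \subset [set v : grid n | v.2 == b])
  (cSv : forall (n : nat) (a : 'I_n),
     #|Sv n a|%:Z = Num.floor (beta * n%:R))
  (cSh : forall (n : nat) (b : 'I_n),
     #|Sh n b|%:Z = Num.floor (beta * n%:R)) :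
  let E := fun n : nat => grid_edges (Sv n) (Sh n) in
  let Z := fun n : nat =>
    edge_form (E n) (fun v : grid n => X (v.1 : nat, v.2 : nat)) in
  verifies_irreducible_CLT E Z.
Proof.
move=> E Z; split; first exact: (grid_irreducible hbeta hSv hSh cSv cSh).
exact: (grid_CLT hX hbeta hSv hSh cSv cSh).
Qed.
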